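(* Let $\Bbbk$ be a field, let $R=\Bbbk[x_1,\dots,x_{11},y_1,\dots,y_{19},z_1,\dots,z_{29}]$, and let $$I=I_1+I_2+I_3\subset R,$$ where $I_1=(x_1x_2,x_2x_3,\dots,x_{10}x_{11},x_{11}x_1)$, $I_2=(y_1y_2,y_2y_3,\dots,y_{18}y_{19},y_{19}y_1)$ and $I_3=(z_1z_2,z_2z_3,\dots,z_{28}z_{29},z_{29}z_1)$ are the edge ideals of the cycles $C_{11}$, $C_{19}$, $C_{29}$, so that $I$ is the edge ideal of the disjoint union of these three odd cycles. Let $w_1=\prod_{i=1}^{11}x_i$, $w_2=\prod_{j=1}^{19}y_j$, $w_3=\prod_{k=1}^{29}z_k$. Then $$\mathcal R_s(I)=R[It,\,w_1t^6,\,w_2t^{10},\,w_3t^{15}],$$ so $\mathcal R_s(I)$ is generated over $R$ in degrees $1,6,10,15$, and $$\operatorname{svd}(I)=60=2\operatorname{lcm}(1,6,10,15).$$ In particular, $\operatorname{svd}(I)>\operatorname{lcm}(1,6,10,15)=30$, so the standard Veronese degree of a monomial ideal need not be bounded above by the least common multiple of the degrees of a set of algebra generators of its symbolic Rees algebra.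
   Context: For an ideal $I$ of a Noetherian commutative ring $R$ and $m\ge 1$, the $m$-th symbolic power of $I$ is $I^{(m)}=\bigcap_{\mathfrak p\in \operatorname{Ass}(I)}(I^mR_{\mathfrak p}\cap R)$, where $\operatorname{Ass}(I)$ is the set of associated primes of $R/I$, and $I^{(0)}=R$. The symbolic Rees algebra of $I$ is $\mathcal R_s(I)=\bigoplus_{m\ge 0}I^{(m)}t^m\subseteq R[t]$, graded by the exponent of $t$. The standard Veronese degree of $I$ is $\operatorname{svd}(I)=\inf\{d\ge 1\mid I^{(dk)}=(I^{(d)})^k\text{ for all }k\ge 1\}$. *)

(* Defs.v *)
From mathcomp Require Import all_boot all_order all_algebra.
From mathcomp Require Import boolp classical_sets.
From mathcomp Require Import mpoly.
Set Implicit Arguments.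
Unset Strict Implicit.
Unset Printing Implicit Defensive.
Import GRing.Theory.
Local Open Scope classical_set_scope.
Local Open Scope ring_scope.

(* Ideals are represented by classical sets of elements of an integral domain
   [R]; the domain hypothesis lets every localization [R_p] live inside the
   fraction field of [R]. *)
Section Ideals.
Variable R : idomainType.
Local Notation "x %:F" := (@FracField.tofrac R x).
Implicit Types (I J p S : set R) (m d : nat).

Definition ideal_gen S : set R :=
  [set x | exists (n : nat) (c s : 'I_n -> R),
     (forall i, S (s i)) /\ x = \sum_(i < n) c i * s i].

Definition ideal_add I J : set R := [set a + b | a in I & b in J].

Definition ideal_mul I J : set R := ideal_gen [set a * b | a in I & b in J].

Definition ideal_pow I m : set R := iter m (ideal_mul I) setT.

(* [idealr_closed] includes [1 \notin p]. *)
Definition prime_ideal p : Prop :=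
  idealr_closed (mem p) /\ prime_idealr_closed (mem p).

(* The prime ideals that are annihilators of the class of some [f] in [R/I]. *)
Definition Ass I : set (set R) :=
  [set p | prime_ideal p /\ exists f, p = [set a | I (a * f)]].

(* R_p, as a subset of Frac(R). *)
Definition localization p : set {fraction R} :=
  [set x | exists a s, ~ p s /\ x = a%:F / s%:F].

(* The extended ideal J R_p. *)
Definition extension J p : set {fraction R} :=
  [set x | exists (n : nat) (u : 'I_n -> {fraction R}) (a : 'I_n -> R),
     [/\ forall i, localization p (u i), forall i, J (a i) &
         x = \sum_(i < n) u i * (a i)%:F]].

Definition symbolic_power I m : set R :=
  if m is 0 then setT
  else \bigcap_(p in Ass I) [set f | extension (ideal_pow I m) p f%:F].

(* The variable ['X] of [{poly R}] plays the role of t. *)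
Definition symbolic_Rees I : set {poly R} :=
  [set F : {poly R} | forall m, symbolic_power I m F`_m].

(* R[G]: the smallest R-subalgebra of R[t] containing G. *)
Definition subalg_gen (G : set {poly R}) : set {poly R} :=
  smallest (fun A : set {poly R} => GRing.subalg_closed (mem A)) G.

(* The pairs [(d, a)] of [gens] encode nonzero homogeneous elements a t^d of
   positive degree that generate the symbolic Rees algebra over R. *)
Definition Rees_generators I (gens : seq (nat * R)) : Prop :=
  (forall g, g \in gens ->
     [/\ (0 < g.1)%N, g.2 != 0 & symbolic_power I g.1 g.2]) /\
  symbolic_Rees I = subalg_gen [set g.2 *: 'X^(g.1) | g in [set` gens]].

Definition svd_set I : set nat :=
  [set d | (0 < d)%N /\ forall k, (0 < k)%N ->
     symbolic_power I (d * k) = ideal_pow (symbolic_power I d) k].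

End Ideals.

(* Infimum in [nat] extended by infinity, [None] being infinity (the infimum
   of the empty set). *)
Definition nat_inf (A : set nat) : option nat :=
  match pselect (exists n, n \in A) with
  | left exA => Some (ex_minn exA)
  | right _ => None
  end.

Definition svd (R : idomainType) (I : set R) : option nat := nat_inf (svd_set I).

(* m < o, with [None] read as infinity. *)
Definition ext_ltn (m : nat) (o : option nat) : bool :=
  if o is Some d then (m < d)%N else true.

Definition lcm_seq (s : seq nat) : nat := \big[lcmn/1%N]_(d <- s) d.

Definition monomial_ideal (k : fieldType) (n : nat) (J : set {mpoly k[n]}) :=
  exists M : set 'X_{1..n}, J = ideal_gen [set 'X_[m] | m in M].

(* Edge ideal of the graph with adjacency [e], the vertex [a] being labelled
   by the ring element [v a]. *)
Definition edge_ideal (R : idomainType) (V : Type) (e : rel V) (v : V -> R) :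
  set R := ideal_gen [set f | exists a b, e a b /\ f = v a * v b].

(* [ordS] is the cyclic successor of ['I_n]. *)
Definition cycle_graph (n : nat) : rel 'I_n :=
  fun i j => (j == ordS i) || (i == ordS j).

Definition disjoint_union (V W : Type) (e : rel V) (f : rel W) : rel (V + W) :=
  fun a b => match a, b with
             | inl a, inl b => e a b
             | inr a, inr b => f a b
             | _, _ => false
             end.

(* (v_1 v_2, v_2 v_3, ..., v_(n-1) v_n, v_n v_1) *)
Definition cycle_ideal (R : idomainType) (n : nat) (v : 'I_n -> R) : set R :=
  ideal_gen [set v i * v (ordS i) | i in setT].

Section Variables.
Variable k : fieldType.
Let R := {mpoly k[11 + 19 + 29]}.

Definition x_ (i : 'I_11) : R := 'X_(lshift 29 (lshift 19 i)).
Definition y_ (j : 'I_19) : R := 'X_(lshift 29 (rshift 11 j)).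
Definition z_ (l : 'I_29) : R := 'X_(rshift (11 + 19) l).

Definition xyz (a : 'I_11 + 'I_19 + 'I_29) : R :=
  match a with inl (inl i) => x_ i | inl (inr j) => y_ j | inr l => z_ l end.

End Variables.

(* Main.v *)
(* Powers and symbolic powers of the edge ideal of a graph are spanned by
   monomials, and X^a lies in the m-th symbolic power iff every vertex cover has
   a-weight at least m: the associated primes are generated by the minimal
   covers, and the localization at such a prime is read off from the order in t
   after substituting X_i t for X_i at the vertices of the cover.

   On an odd cycle of length 2 h + 1 a min-max theorem holds: the least weight
   of a cover equals the greatest value c (h + 1) + (number of edges) of a
   packing of c copies of the whole cycle and some edges.  Hence X^a lies in the
   m-th symbolic power of I iff it is divisible by a product of E edges and
   w1^A w2^B w3^C with E + 6 A + 10 B + 15 C >= m, which gives the generators.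

   For the Veronese degree, comparing degrees of w_i^d shows that 6, 10 and 15
   divide d; d = 30 fails since w1^4 w2^2 w3 times an edge of the first cycle
   has value 60 but no subfamily of value 30; and d = 60 works since every
   family of parts 1, 6, 10, 15 of value at least 120 has a subfamily of value
   60. *)
Require Import Defs.
From mathcomp Require Import all_boot all_order all_algebra.
From mathcomp Require Import boolp classical_sets.
From mathcomp Require Import mpoly zify.
Set Implicit Arguments.
Unset Strict Implicit.
Unset Printing Implicit Defensive.
Import GRing.Theory.
(** * Packings and covers of odd cycles *)

(** Functions on the cycle Z/N are encoded as N-periodic functions on [nat], so that neighbours are
    [j] and [j.+1] without reduction modulo N; the predecessor of [j] appears as [j + N.-1]. *)
Definition periodic (T : Type) (N : nat) (f : nat -> T) :=
  forall j, f (j + N) = f j.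

Definition cover (N : nat) (b : nat -> bool) :=
  periodic N b /\ forall j, b j || b j.+1.

Definition covers_ge (N m : nat) (a : nat -> nat) :=
  forall b, cover N b -> m <= \sum_(j < N) b j * a j.

(** [x j] is the multiplicity of the edge joining [j - 1] and [j], so vertex [j] meets the edges
    counted by [x j] and [x j.+1]. A copy of the whole cycle is worth [uphalf N], which is h + 1 for
    N = 2 h + 1. *)
Definition packing (N m : nat) (a : nat -> nat) :=
  exists (c : nat) (x : nat -> nat), [/\ periodic N x,
    forall j, c + x j + x j.+1 <= a j &
    m <= c * uphalf N + \sum_(j < N) x j].

Lemma sum_shift N (f : nat -> nat) k : periodic N f ->
  \sum_(j < N) f (k + j) = \sum_(j < N) f j.
Proof.
move=> fN; elim: k => [|k <-]; first by [].
case: N fN => [|N] fN; first by rewrite !big_ord0.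
rewrite big_ord_recr [RHS]big_ord_recl /= addnC; congr (_ + _).
  by rewrite addn0 -(fN k); congr f; lia.
by apply: eq_bigr => j _; congr f; rewrite /bump; lia.
Qed.

Lemma cover_shift N b : 0 < N -> cover N b -> cover N (fun j => b (j + N.-1)).
Proof.
move=> N0 [bN cb]; split=> [j|j].
  by rewrite -(bN (j + N.-1)); congr b; lia.
by rewrite addSn; apply: cb.
Qed.

Lemma covers_ge_shift1 N m a : 0 < N -> periodic N a ->
  covers_ge N m a -> covers_ge N m (fun j => a j.+1).
Proof.
move=> N0 aN H b bP; have [bN _] := bP.
apply: leq_trans (H _ (cover_shift N0 bP)) _.
rewrite -(@sum_shift N (fun j => b (j + N.-1) * a j) 1); last first.
  by move=> j; rewrite aN -(bN (j + N.-1)); congr (b _ * _); lia.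
apply: leq_sum => j _; rewrite -(bN j) add1n.
by have -> : j.+1 + N.-1 = j + N by lia.
Qed.

Lemma packing_shift1 N m a : 0 < N -> periodic N a ->
  packing N m (fun j => a j.+1) -> packing N m a.
Proof.
move=> N0 aN [c [x [xN xa mx]]].
exists c, (fun j => x (j + N.-1)); split.
- by move=> j; rewrite -(xN (j + N.-1)); congr x; lia.
- move=> j; rewrite -(aN j); have := xa (j + N.-1).
  by have -> : j + N = (j + N.-1).+1 by lia.
apply: leq_trans mx _; rewrite leq_add2l -(sum_shift N.-1 xN).
by apply: leq_sum => j _; rewrite addnC.
Qed.

Lemma covers_ge_shift N m a k : 0 < N -> periodic N a ->
  covers_ge N m a -> covers_ge N m (fun j => a (k + j)).
Proof.
move=> N0; elim: k a => [//|k IH] a aN H b bP.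
apply: (IH (fun j => a j.+1)) => //; first by move=> j; rewrite -addSn aN.
exact: covers_ge_shift1.
Qed.

Lemma packing_shift N m a k : 0 < N -> periodic N a ->
  packing N m (fun j => a (k + j)) -> packing N m a.
Proof.
move=> N0; elim: k a => [//|k IH] a aN H.
apply: packing_shift1 => //; apply: IH => //.
by move=> j; rewrite -addSn aN.
Qed.

(** Weight of the cover k, k + 2, ..., k + 2 h of the cycle of length 2 h + 1; it closes up because
    k + 2 h is the predecessor of k. *)
Definition alt_sum h (a : nat -> nat) k := \sum_(i < h.+1) a (k + i.*2).

Lemma alt_sumE h a k :
  alt_sum h a k = \sum_(j < h.*2.+1) (~~ odd j) * a (k + j).
Proof.
rewrite /alt_sum; elim: h => [|h IH].
  by rewrite !big_ord_recr !big_ord0 /= mul1n.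
rewrite big_ord_recr IH doubleS [RHS]big_ord_recr [in RHS]big_ord_recr /=.
by rewrite !odd_double /= mul0n mul1n addn0.
Qed.

Lemma alt_sum_periodic h a : periodic h.*2.+1 a ->
  periodic h.*2.+1 (alt_sum h a).
Proof. by move=> aN j; apply: eq_bigr => i _; rewrite addnAC aN. Qed.

(** The two covers together run once through 2 h + 2 consecutive indices from k on, and the last of
    these is k again. *)
Lemma alt_sumS h a k : periodic h.*2.+1 a ->
  alt_sum h a k + alt_sum h a k.+1 = \sum_(j < h.*2.+1) a j + a k.
Proof.
move=> aN; rewrite -(sum_shift k aN) -(aN k) /alt_sum.
have -> : \sum_(j < h.*2.+1) a (k + j) + a (k + h.*2.+1) =
  \sum_(j < h.+1.*2) a (k + j) by rewrite doubleS [RHS]big_ord_recr.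
elim: (h.+1) => [|g IH]; first by rewrite !big_ord0.
by rewrite !big_ord_recr /= -IH addnACA addnA addSnnS.
Qed.

Lemma sum_alt_sum h a : periodic h.*2.+1 a ->
  \sum_(k < h.*2.+1) alt_sum h a k = h.+1 * \sum_(j < h.*2.+1) a j.
Proof.
move=> aN; rewrite exchange_big /=.
transitivity (\sum_(i < h.+1) \sum_(j < h.*2.+1) a j); last first.
  by rewrite sum_nat_const card_ord.
apply: eq_bigr => i _; rewrite -(sum_shift i.*2 aN).
by apply: eq_bigr => j _; rewrite addnC.
Qed.

Lemma modn_succ N j : j %% N < N ->
  j.+1 %% N = if (j %% N).+1 == N then 0 else (j %% N).+1.
Proof.
move=> lt; rewrite -addn1 -modnDml addn1.
by case: eqP => [->|/eqP ne]; rewrite ?modnn // modn_small //; lia.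
Qed.

Lemma alt_cover h : cover h.*2.+1 (fun j => ~~ odd (j %% h.*2.+1)).
Proof.
split=> j; first by rewrite modnDr.
have := ltn_pmod j (ltn0Sn h.*2); rewrite ltnS leq_eqVlt => /orP[/eqP jh|jh].
  by rewrite jh odd_double.
rewrite modn_succ ?ltn_pmod // ifN; last by rewrite eqSS neq_ltn jh.
by rewrite /= negbK; case: odd.
Qed.

Lemma alt_sum_ge h m a k : periodic h.*2.+1 a -> covers_ge h.*2.+1 m a ->
  m <= alt_sum h a k.
Proof.
move=> aN /(covers_ge_shift k (ltn0Sn _) aN) /(_ _ (alt_cover h)).
by rewrite alt_sumE; under eq_bigr => j _ do rewrite modn_small //.
Qed.

(* The fractional case: the solution of [x j + x j.+1 = a j - c] is unique on
   an odd cycle, and [alt_sum] provides it. *)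
Lemma packing_alt h m a : periodic h.*2.+1 a -> covers_ge h.*2.+1 m a ->
  (forall k, \sum_(j < h.*2.+1) a j <= 2 * alt_sum h a k) ->
  packing h.*2.+1 m a.
Proof.
move=> aN H le2; set s := \sum_(j < _) a j in le2.
(* This choice makes [2 * M - s] and every [alt_sum h a k - M] true differences, not truncated
   ones. *)
pose M := maxn m (uphalf s).
have leM k : M <= alt_sum h a k.
  by rewrite geq_max (alt_sum_ge k aN H); have := le2 k; lia.
exists (2 * M - s), (fun k => alt_sum h a k - M); split.
- by move=> j; rewrite alt_sum_periodic.
- move=> j; have := alt_sumS j aN; rewrite -/s.
  by have := leM j; have := leM j.+1; lia.
(* The value of the packing is (2 M - s) (h + 1) + (h + 1) s - (2 h + 1) M = M. *)
have : \sum_(k < h.*2.+1) (alt_sum h a k - M) + h.*2.+1 * M = h.+1 * s.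
  have -> : h.*2.+1 * M = \sum_(k < h.*2.+1) M by rewrite sum_nat_const card_ord.
  rewrite -(sum_alt_sum aN) -big_split.
  by apply: eq_bigr => k _; rewrite /= subnK.
have -> : uphalf h.*2.+1 = h.+1 by lia.
set X := \sum_(k < _) _; have : s <= 2 * M by lia.
have : m <= M by rewrite leq_maxl.
nia.
Qed.

(** * Greedy packings and covers of a path *)

Fixpoint greedy (a : nat -> nat) (k : nat) : nat :=
  if k is j.+1 then minn (a j - greedy a j) (a k) else 0.

Lemma greedy_le a k : greedy a k <= a k.
Proof. by case: k => //= k; rewrite geq_minr. Qed.

Lemma greedyD a k : greedy a k + greedy a k.+1 <= a k.
Proof. by have := greedy_le a k; rewrite /=; lia. Qed.

Lemma greedy_cover a k :
  let X := \sum_(j < k.+1) greedy a j in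
  let path_cover b := forall j, j < k -> b j || b j.+1 in
  (exists b : nat -> bool, [/\ path_cover b, b k &
     \sum_(j < k.+1) b j * a j = X + (a k - greedy a k)]) /\
  (exists2 b : nat -> bool, path_cover b & \sum_(j < k.+1) b j * a j = X).
Proof.
elim: k => [|k [[b1 [c1 b1k w1]] [b2 c2 w2]]] /=.
  split; first by exists xpredT; rewrite !big_ord_recr !big_ord0 /= subn0 mul1n.
  by exists xpred0 => //; rewrite !big_ord_recr !big_ord0.
pose set_last (b : nat -> bool) v j := if j == k.+1 then v else b j.
have sum_set b v : \sum_(j < k.+1) set_last b v j * a j = \sum_(j < k.+1) b j * a j.
  apply: eq_bigr => j _; rewrite /set_last ifN //.
  by have := ltn_ord j; lia.
have set_k1 b v : set_last b v k.+1 = v by rewrite /set_last eqxx.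
have cov b v : (forall j, j < k -> b j || b j.+1) -> b k || v ->
    forall j, j < k.+1 -> set_last b v j || set_last b v j.+1.
  move=> cb bk j; rewrite ltnS leq_eqVlt => /orP[/eqP->|jk].
    by rewrite set_k1 /set_last ifN //; lia.
  by rewrite /set_last !ifN ?cb //; lia.
(* Adding [k.+1] to the unrestricted cover gives the new forced one. The new unrestricted cover is
   the old forced one or, when [greedy a k.+1 = a k.+1], the new forced one, whose slack is then
   zero. *)
have tr : exists b : nat -> bool, [/\ forall j, j < k.+1 -> b j || b j.+1,
    b k.+1 & \sum_(j < k.+2) b j * a j =
     \sum_(j < k.+2) greedy a j + (a k.+1 - greedy a k.+1)].
  exists (set_last b2 true); split; rewrite ?set_k1 //.
    by apply: cov => //; rewrite orbT.
  by rewrite !(big_ord_recr k.+1) sum_set w2 set_k1 /= mul1n; lia.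
split=> //; case: (leqP (a k - greedy a k) (a k.+1)) => le.
  exists (set_last b1 false); first by apply: cov; rewrite ?b1k.
  by rewrite !(big_ord_recr k.+1) sum_set w1 set_k1 /= mul0n; lia.
have [b [cb bk1 wb]] := tr; exists b => //.
by rewrite wb /=; lia.
Qed.

(* If the cover misses both ends, exchange it with its complement beyond its
   last pair of consecutive vertices: minimality of the alternating sum at [0]
   shows that this does not increase the weight. *)
Lemma path_cover_ge h m a (b : nat -> bool) :
  periodic h.*2.+1 a -> covers_ge h.*2.+1 m a ->
  2 * alt_sum h a 0 <= \sum_(j < h.*2.+1) a j ->
  (forall k, alt_sum h a 0 <= alt_sum h a k) ->
  (forall j, j < h.*2 -> b j || b j.+1) ->
  m <= \sum_(j < h.*2.+1) b j * a j.
Proof.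
set N := h.*2.+1 => aN H le2 mn cb.
(* A path cover containing an end also covers the closing edge, so it extends to a cover of the
   cycle. *)
have use (b' : nat -> bool) : (forall j, j < h.*2 -> b' j || b' j.+1) ->
    b' 0 || b' h.*2 -> m <= \sum_(j < N) b' j * a j.
  move=> cb' ends; have := H (fun j => b' (j %% N)).
  under eq_bigr => j _ do rewrite modn_small //.
  apply; split=> j; first by rewrite modnDr.
  have := ltn_pmod j (ltn0Sn h.*2); rewrite ltnS leq_eqVlt => /orP[/eqP jh|jh].
    rewrite modn_succ ?ltn_pmod // jh eqxx.
    by rewrite orbC.
  rewrite modn_succ ?ltn_pmod // ifN; last by rewrite eqSS neq_ltn jh.
  exact: cb'.
case: (boolP (b 0 || b h.*2)) => [|/norP[b0 bN]]; first exact: use.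
have exq : exists q, [forall j : 'I_N, (q <= j) ==> (b j == odd j)].
  exists N; apply/forallP => j; apply/implyP => Nj.
  by have := ltn_ord j; rewrite ltnNge Nj.
case: (ex_minnP exq) => q /forallP qP qmin.
have {}qP j : q <= j -> j < N -> b j = odd j.
  by move=> qj jN; have /implyP/(_ qj)/eqP := qP (Ordinal jN).
have qN : q <= h.*2.
  apply: qmin; apply/forallP => j; apply/implyP => hj.
  have -> : nat_of_ord j = h.*2 by apply/eqP; rewrite eqn_leq hj -ltnS ltn_ord.
  by rewrite (negbTE bN) odd_double.
have S0 := alt_sumE h a 0; rewrite -/N in S0.
case: (posnP q) => q0.
  have := alt_sum_ge 0 aN H.
  suff : \sum_(j < N) b j * a j + alt_sum h a 0 = \sum_(j < N) a j by lia.
  rewrite S0 -big_split; apply: eq_bigr => j _ /=.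
  by rewrite qP ?q0 //; case: odd; rewrite /= ?mul1n ?mul0n ?addn0.
(* Minimality of [q] makes [q.-1] and [q] the last consecutive pair of [b], with [q] odd. *)
have bq : b q.-1 != odd q.-1.
  apply/eqP => bq; have : q <= q.-1; last by lia.
  apply: qmin; apply/forallP => j; apply/implyP.
  rewrite leq_eqVlt => /orP[/eqP<-|qj]; first by rewrite bq.
  by rewrite qP //; lia.
have bqq : b q.-1 || odd q.
  by have := cb q.-1; rewrite prednK // (qP q) // => /(_ qN).
have oddq1 : odd q.-1 = ~~ odd q by rewrite -subn1 oddB // addbT.
have oq : odd q.
  by move: bq bqq; rewrite oddq1; case: (odd q); case: (b _).
have bq1 : b q.-1.
  by move: bq; rewrite oddq1 oq; case: (b _).
pose b' j := if j < q then b j else ~~ odd j.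
apply: leq_trans (use b' _ _) _.
- move=> j jh; rewrite /b'; case: ltnP => jq; case: ltnP => jq'; try lia.
  + exact: cb.
  + by have -> : j = q.-1 by [lia]; rewrite bq1.
- by rewrite /b' (ltnNge h.*2) qN /= odd_double orbT.
(* As [q] is odd, the cover starting at [q] takes the odd vertices from [q] on and, past the closing
   edge, the even ones below [q]. *)
have Sq : alt_sum h a q = \sum_(j < N) (if j < q then ~~ odd j else odd j) * a j.
  rewrite alt_sumE -/N.
  pose f j := (~~ odd ((j + (N - q)) %% N)) * a j.
  have fN : periodic N f by move=> j; rewrite /f aN addnAC modnDr.
  transitivity (\sum_(j < N) f (q + j)).
    apply: eq_bigr => j _; rewrite /f.
    have -> : q + j + (N - q) = j + N by lia.
    by rewrite modnDr modn_small.
  rewrite (sum_shift q fN); apply: eq_bigr => j _; rewrite /f.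
  have jN := ltn_ord j; case: ltnP => jq.
    by rewrite modn_small; last lia; congr (nat_of_bool _ * _); rewrite /N; lia.
  have -> : j + (N - q) = (j - q) + N by lia.
  by rewrite modnDr modn_small; last lia; congr (nat_of_bool _ * _); lia.
have := mn q; rewrite Sq S0 => le0.
suff : \sum_(j < N) b' j * a j + \sum_(j < N) (if j < q then ~~ odd j else odd j) * a j
  = \sum_(j < N) b j * a j + \sum_(j < N) (~~ odd j) * a (0 + j) by lia.
rewrite -!big_split; apply: eq_bigr => j _ /=; rewrite /b' add0n.
by case: ltnP => jq //; rewrite qP // addnC.
Qed.

(** If every alternating cover weighs at least half the total, [packing_alt] applies. Otherwise a
    lightest one is rotated to start at 0 and the closing edge is dropped: the greedy packing of the
    path equals the weight of a path cover, which is at least m. *)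
Theorem odd_cycle_packing h m a : periodic h.*2.+1 a ->
  covers_ge h.*2.+1 m a -> packing h.*2.+1 m a.
Proof.
move=> aN H; set N := h.*2.+1 in aN H *.
case: (@arg_minnP 'I_N ord0 xpredT (fun k : 'I_N => alt_sum h a k)) => // k _ kmin.
have {}kmin j : alt_sum h a k <= alt_sum h a j.
  have per i : alt_sum h a (j %% N + i * N) = alt_sum h a (j %% N).
    elim: i => [|i IH]; first by rewrite addn0.
    by rewrite mulSnr addnA alt_sum_periodic.
  rewrite (divn_eq j N) addnC per.
  exact: (kmin (Ordinal (ltn_pmod j (ltn0Sn h.*2)))).
case: (leqP (\sum_(j < N) a j) (2 * alt_sum h a k)) => [le2|lt2].
  by apply: packing_alt => // j; apply: leq_trans le2 _; rewrite leq_mul2l kmin orbT.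
apply: (@packing_shift N m a k) => //.
set a' := fun j => a (k + j).
have aN' : periodic N a' by move=> j; rewrite /a' addnA aN.
have H' : covers_ge N m a' by exact: covers_ge_shift.
have altE j : alt_sum h a' j = alt_sum h a (k + j).
  by apply: eq_bigr => i _; rewrite /a' addnA.
have [_ [b cb wb]] := greedy_cover a' h.*2.
have := path_cover_ge aN' H' _ _ cb; rewrite wb => le.
pose x j := greedy a' (j %% N).
exists 0, x; split.
- by move=> j; rewrite /x modnDr.
- move=> j; rewrite /x add0n.
  have -> : a' j = a' (j %% N).
    rewrite {1}(divn_eq j N); elim: (j %/ N) => [//|i IH].
    by rewrite mulSnr addnAC aN'.
  have := ltn_pmod j (ltn0Sn h.*2); rewrite ltnS leq_eqVlt => /orP[/eqP jh|jh].
    rewrite modn_succ ?ltn_pmod // jh eqxx.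
    by rewrite addn0 greedy_le.
  rewrite modn_succ ?ltn_pmod // ifN; last by rewrite eqSS neq_ltn jh.
  exact: greedyD.
rewrite mul0n add0n.
under eq_bigr => j _ do rewrite /x modn_small //.
apply: le; first by rewrite altE addn0 sum_shift // ltnW.
by move=> j; rewrite !altE addn0.
Qed.

Lemma periodic_mod (T : Type) N (f : nat -> T) j : periodic N f ->
  f (j %% N) = f j.
Proof.
move=> fN; rewrite [in RHS](divn_eq j N) addnC.
by elim: (j %/ N) => [|i IH]; rewrite ?addn0 // mulSnr addnA fN.
Qed.

(** The least weight of a cover serves as m in [odd_cycle_packing]; [y i] counts the edge from i to
    [ordS i], hence the shift [x i.+1]. *)
Theorem odd_cycle_duality h (g : 'I_h.*2.+1 -> nat) :
  exists (B : pred 'I_h.*2.+1) (c : nat) (y : 'I_h.*2.+1 -> nat),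
    [/\ forall i, B i || B (ordS i),
        forall i, c + y i + y (ord_pred i) <= g i &
        \sum_i B i * g i <= c * h.+1 + \sum_i y i].
Proof.
set N := h.*2.+1; pose a j := g (inord (j %% N)).
have aN : periodic N a by move=> j; rewrite /a modnDr.
have ag (i : 'I_N) : a i = g i by rewrite /a modn_small // inord_val.
pose attained m := `[< exists2 b, cover N b & \sum_(j < N) b j * a j = m >].
have ex : exists m, attained m.
  by exists (\sum_(j < N) true * a j); apply/asboolP; exists xpredT.
case: (ex_minnP ex) => m /asboolP[b [bN cb] bm] minm.
have H : covers_ge N m a.
  by move=> b' cb'; apply: minm; apply/asboolP; exists b'.
have [c [x [xN xa mx]]] := odd_cycle_packing aN H.
exists (fun i => b i), c, (fun i => x i.+1); split=> [i|i|].
- by rewrite /= periodic_mod.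
- rewrite -ag; apply: leq_trans (xa i); rewrite -addnA [x _ + _]addnC addnA.
  rewrite leq_add2r leq_add2l.
  suff -> : x (ord_pred i).+1 = x i by [].
  rewrite -(periodic_mod _ xN) -[RHS](periodic_mod _ xN); congr x => /=.
  rewrite -addn1 modnDml addn1 prednK ?addn_gt0 ?orbT //.
  by rewrite modnDr.
under eq_bigr => i _ do rewrite -ag.
rewrite bm; apply: leq_trans mx _.
rewrite leq_add ?leq_mul //; first by rewrite /N /= doubleK.
by rewrite -(sum_shift 1 xN); apply: leq_sum.
Qed.

Local Open Scope classical_set_scope.
Local Open Scope ring_scope.

(** * Ideals *)

Section IdealLemmas.
Variable R : idomainType.
Local Notation "x %:F" := (@FracField.tofrac R x).
Implicit Types I J p : set R.

Definition is_ideal I : Prop :=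
  [/\ I 0, forall x y, I x -> I y -> I (x + y) & forall c x, I x -> I (c * x)].

Lemma ideal_sum I (T : Type) (r : seq T) (P : pred T) (F : T -> R) :
  is_ideal I -> (forall i, P i -> I (F i)) -> I (\sum_(i <- r | P i) F i).
Proof. by move=> [I0 ID _] IF; elim/big_ind: _. Qed.

Lemma ideal_gen_sub S I : is_ideal I -> S `<=` I -> ideal_gen S `<=` I.
Proof.
move=> iI SI x [n [c [s [Ss ->]]]]; have [_ _ IM] := iI.
by apply: ideal_sum => // i _; apply: IM; apply: SI.
Qed.

Lemma ideal_gen_sup (S : set R) : S `<=` ideal_gen S.
Proof.
move=> x Sx; exists 1%N, (fun=> 1), (fun=> x); split=> //.
by rewrite big_ord1 mul1r.
Qed.

Lemma ideal_gen_is_ideal (S : set R) : is_ideal (ideal_gen S).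
Proof.
split.
- by exists 0%N, (fun=> 0), (fun=> 0); split; [case|rewrite big_ord0].
- move=> x y [n [c [s [Ss ->]]]] [n' [c' [s' [Ss' ->]]]].
  pose u T (f : 'I_n -> T) (g : 'I_n' -> T) (i : 'I_(n + n')) :=
    match split i with inl j => f j | inr j => g j end.
  exists (n + n')%N, (u _ c c'), (u _ s s'); split.
    by move=> i; rewrite /u; case: (split i).
  rewrite big_split_ord /u; congr (_ + _); apply: eq_bigr => i _.
    by case: split_ordP => j /eqP; rewrite ?eq_lshift ?eq_lrshift // => /eqP->.
  by case: split_ordP => j /eqP; rewrite ?eq_rshift ?eq_rlshift // => /eqP->.
- move=> d x [n [c [s [Ss ->]]]]; exists n, (fun i => d * c i), s; split=> //.
  by rewrite mulr_sumr; apply: eq_bigr => i _; rewrite mulrA.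
Qed.

Lemma prime_idealP p : prime_ideal p <->
  [/\ is_ideal p, ~ p 1 & forall x y, p (x * y) -> p x \/ p y].
Proof.
split=> [[[/set_mem p0 p1 pD] pp]|[[p0 pD pM] p1 pp]].
  split.
  - split=> // [x y px py|c x px].
      by apply/set_mem; rewrite -[x]mul1r; apply: pD; apply/mem_set.
    by apply/set_mem; rewrite -[_ * _]addr0; apply: pD; apply/mem_set.
  - by move=> /mem_set; rewrite (negbTE p1).
  - by move=> x y /mem_set /pp /orP[] /set_mem; [left|right].
split; first split.
- exact/mem_set.
- by apply/negP => /set_mem.
- by move=> c x y /set_mem px /set_mem py; apply/mem_set; apply: pD => //; apply: pM.
- by move=> x y /set_mem /pp[] /mem_set ->; rewrite ?orbT.
Qed.

(** Denominators are cleared by their product, which stays outside p because p is prime. *)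
Lemma extensionP J p f : prime_ideal p -> is_ideal J ->
  extension J p f%:F <-> exists2 s, ~ p s & J (s * f).
Proof.
move=> /prime_idealP[[p0 _ _] p1 pM] iJ; have [J0 JD JM] := iJ; split; last first.
  move=> [s ps Jsf]; exists 1%N, (fun=> 1%:F / s%:F), (fun=> s * f); split=> //.
    by exists 1, s.
  rewrite big_ord1 rmorphM /= mulrA rmorph1 mul1r mulVf ?mul1r //.
  by rewrite tofrac_eq0; apply/eqP => s0; apply: ps; rewrite s0.
move=> [n [u [a [pu Ja fE]]]].
suff [s ps [x Jx sx]] : exists2 s, ~ p s &
    exists2 x, J x & s%:F * (\sum_(i < n) u i * (a i)%:F) = x%:F.
  exists s => //; suff -> : s * f = x by [].
  by apply/eqP; rewrite -tofrac_eq rmorphM /= fE sx.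
elim: n u a pu Ja {fE} => [|n IH] u a pu Ja.
  by exists 1 => //; exists 0 => //; rewrite big_ord0 mulr0 rmorph0.
have [s ps [x Jx sx]] := IH _ _ (fun i => pu (lift ord0 i)) (fun i => Ja (lift ord0 i)).
have [b [t [pt ut]]] := pu ord0.
have t0 : t%:F != 0 by rewrite tofrac_eq0; apply/eqP => t0; apply: pt; rewrite t0.
exists (s * t); first by move=> /pM[].
exists (s * b * a ord0 + t * x); first by apply: JD; apply: JM.
rewrite big_ord_recl mulrDr ut rmorphD !rmorphM /=; congr (_ + _).
  by rewrite [b%:F / _]mulrC -!mulrA mulVKf.
by rewrite [s%:F * _]mulrC -mulrA sx.
Qed.

Lemma ideal_add_is_ideal I J : is_ideal I -> is_ideal J ->
  is_ideal (ideal_add I J).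
Proof.
move=> [I0 ID IM] [J0 JD JM]; split.
- by exists 0 => //; exists 0 => //; rewrite addr0.
- move=> _ _ [x Ix [y Jy <-]] [x' Ix' [y' Jy' <-]].
  by exists (x + x'); [exact: ID|exists (y + y'); [exact: JD|rewrite addrACA]].
- move=> c _ [x Ix [y Jy <-]].
  by exists (c * x); [exact: IM|exists (c * y); [exact: JM|rewrite mulrDr]].
Qed.

Lemma ideal_add_gen (S T : set R) :
  ideal_add (ideal_gen S) (ideal_gen T) = ideal_gen (S `|` T).
Proof.
have iST := ideal_gen_is_ideal (S `|` T); have [_ STD _] := iST.
have iS := ideal_gen_is_ideal S; have iT := ideal_gen_is_ideal T.
apply/seteqP; split.
  move=> _ [x Sx [y Ty <-]]; apply: STD.
    by apply: ideal_gen_sub Sx => // z Sz; apply: ideal_gen_sup; left.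
  by apply: ideal_gen_sub Ty => // z Tz; apply: ideal_gen_sup; right.
apply: ideal_gen_sub; first exact: ideal_add_is_ideal.
have [S0 _ _] := iS; have [T0 _ _] := iT.
move=> z [Sz|Tz].
  by exists z; [exact: ideal_gen_sup|exists 0 => //; rewrite addr0].
by exists 0 => //; exists z; [exact: ideal_gen_sup|rewrite add0r].
Qed.

Lemma edge_ideal_disjoint_union (V W : Type) (e : rel V) (f : rel W)
    (u : V + W -> R) :
  edge_ideal (disjoint_union e f) u =
  ideal_add (edge_ideal e (u \o inl)) (edge_ideal f (u \o inr)).
Proof.
rewrite ideal_add_gen; congr ideal_gen; apply/seteqP; split=> x.
  by move=> [[a|a] [[b|b] [//= ab ->]]]; [left|right]; exists a, b.
by move=> [|] [a [b [ab ->]]]; [exists (inl a), (inl b)|exists (inr a), (inr b)].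
Qed.

Lemma cycle_idealE n (v : 'I_n -> R) :
  cycle_ideal v = edge_ideal (@cycle_graph n) v.
Proof.
congr ideal_gen; apply/seteqP; split=> [_ [i _ <-]|x [i [j [+ ->]]]].
  by exists i, (ordS i); rewrite /cycle_graph eqxx.
move=> /orP[] /eqP->; first by exists i.
by exists j => //; rewrite mulrC.
Qed.

End IdealLemmas.

(** * Monomial ideals *)

Section MonomialIdeals.
Variables (k : fieldType) (n : nat).
Local Notation R := {mpoly k[n]}.
Implicit Types (S T M : set 'X_{1..n}) (a b : 'X_{1..n}) (f g : R).

Definition mspan S : set R := [set f | forall a, a \in msupp f -> S a].

Definition upset S := forall a b, S a -> (a <= b)%MM -> S b.

Definition upclose M : set 'X_{1..n} := [set a | exists2 b, M b & (b <= a)%MM].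

Definition msum S T : set 'X_{1..n} :=
  [set a | exists b c, [/\ S b, T c & a = (b + c)%MM]].

Definition mpow S m : set 'X_{1..n} := iter m (msum S) setT.

Lemma upclose_up M : upset (upclose M).
Proof. by move=> a b [c Mc ca] ab; exists c => //; apply: lepm_trans ca ab. Qed.

Lemma msum_up S T : upset T -> upset (msum S T).
Proof.
move=> uT _ d [b [c [Sb Tc ->]]] le; exists b, (d - b)%MM; split=> //.
  apply: uT Tc _; apply/mnm_lepP => i; move/mnm_lepP: le => /(_ i).
  by rewrite mnmDE mnmBE; lia.
by rewrite addmC submK //; apply: lepm_trans le; apply: lem_addr.
Qed.

Lemma mpow_up S m : upset (mpow S m).
Proof. by case: m => [//|m]; elim: m => [|m IH]; apply: msum_up. Qed.

Lemma mspanX S a : mspan S 'X_[a] <-> S a.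
Proof. by rewrite /mspan /= msuppX; split=> [|Sa b]; [apply; rewrite inE|rewrite inE => /eqP->]. Qed.

Lemma mspan_inj S T : mspan S = mspan T -> S = T.
Proof.
by move=> ST; apply/seteqP; split=> a; rewrite -!mspanX ST.
Qed.

Lemma mspan_ideal S : upset S -> is_ideal (mspan S).
Proof.
move=> uS; split=> [a|f g Sf Sg a|f g Sg a].
- by rewrite msupp0.
- by move=> /msuppD_le; rewrite mem_cat => /orP[/Sf|/Sg].
- by move=> /msuppM_le /allpairsP[[b c] /= [_ /Sg Sc ->]]; apply: uS Sc _; apply: lem_addl.
Qed.

Lemma mspan_sub S (I : set R) : is_ideal I -> (forall a, S a -> I 'X_[a]) ->
  mspan S `<=` I.
Proof.
move=> iI SI f Sf; rewrite [f]mpolyE big_seq.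
apply: ideal_sum => // a /Sf/SI Ia; have [_ _ IM] := iI.
by rewrite -mul_mpolyC; apply: IM.
Qed.

Lemma ideal_gen_mspan M : ideal_gen [set 'X_[a] | a in M] = mspan (upclose M).
Proof.
apply/seteqP; split.
  apply: ideal_gen_sub; first exact/mspan_ideal/upclose_up.
  by move=> _ [a Ma <-]; apply/mspanX; exists a => //; apply: lepm_refl.
have iI := ideal_gen_is_ideal [set ('X_[a] : R) | a in M].
apply: mspan_sub => // a [b Mb ba]; have [_ _ IM] := iI.
rewrite -(submK ba) mpolyXD; apply: IM; apply: ideal_gen_sup; exact: imageP.
Qed.

Lemma ideal_mul_mspan S T : upset T ->
  ideal_mul (mspan S) (mspan T) = mspan (msum S T).
Proof.
move=> uT; apply/seteqP; split.
  apply: ideal_gen_sub; first exact/mspan_ideal/msum_up.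
  move=> _ [f Sf [g Tg <-]] a /msuppM_le /allpairsP[[b c] /= [/Sf Sb /Tg Tc ->]].
  by exists b, c.
apply: mspan_sub; first exact: ideal_gen_is_ideal.
move=> _ [b [c [Sb Tc ->]]]; apply: ideal_gen_sup.
by rewrite mpolyXD; exists 'X_[b]; [apply/mspanX|exists 'X_[c] => //; apply/mspanX].
Qed.

Lemma ideal_pow_mspan S m : ideal_pow (mspan S) m = mspan (mpow S m).
Proof.
elim: m => [|m IH]; first by apply/seteqP; split.
by rewrite /ideal_pow /= -/(ideal_pow _ m) IH ideal_mul_mspan //; apply: mpow_up.
Qed.

End MonomialIdeals.

Arguments mspan k {n} S _.

(** * Symbolic powers of edge ideals *)

(** Over a domain, a factor with nonzero constant term does not change the t-adic order. *)
Lemma low_coef_cancel (R : idomainType) (p q : {poly R}) m : p`_0 != 0 ->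
  (forall j, (j < m)%N -> (p * q)`_j = 0) -> forall j, (j < m)%N -> q`_j = 0.
Proof.
move=> p0 H; elim/ltn_ind => j IH jm; have := H j jm.
rewrite coefM big_ord_recl /= subn0 big1; last first.
  move=> i _; rewrite (IH (j - bump 0 i)%N) ?mulr0 // /bump /=.
    by have := ltn_ord i; lia.
  by lia.
by rewrite addr0 => /eqP; rewrite mulf_eq0 (negbTE p0) /= => /eqP.
Qed.

Section SymbolicPowers.
Variables (k : fieldType) (n : nat) (e : rel 'I_n).
Hypotheses (e_sym : ssrbool.symmetric e) (e_irr : irreflexive e).
Local Notation R := {mpoly k[n]}.
Implicit Types (a b : 'X_{1..n}) (f g : R) (C : {set 'I_n}).

Definition edge_mnm : set 'X_{1..n} :=
  [set a | exists i j, e i j /\ a = (U_(i) + U_(j))%MM].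

Definition wt C a : nat := (\sum_(i in C) a i)%N.

Definition vertex_cover C : bool :=
  [forall i, forall j, e i j ==> (i \in C) || (j \in C)].

Definition sym_set m : set 'X_{1..n} :=
  [set a | forall C, vertex_cover C -> (m <= wt C a)%N].

Local Notation E1 := (upclose edge_mnm).

Lemma edge_ideal_mspan : edge_ideal e (fun i => 'X_i : R) = mspan k E1.
Proof.
rewrite -ideal_gen_mspan; congr ideal_gen; apply/seteqP; split=> [f|_ [a + <-]].
  by move=> [i [j [ij ->]]]; exists (U_(i) + U_(j))%MM; [exists i, j|rewrite mpolyXD].
by move=> [i [j [ij ->]]]; exists i, j; rewrite mpolyXD.
Qed.

(** Without loops the two ends of an edge differ, so divisibility by an edge monomial depends only
    on the support. *)
Lemma upclose_edgeP a : E1 a <-> exists i j, [/\ e i j, (0 < a i)%N & (0 < a j)%N].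
Proof.
split=> [[b [i [j [ij ->]]] /mnm_lepP le]|[i [j [ij ai aj]]]].
  exists i, j; split=> //; apply: leq_trans (le _); rewrite mnmDE !mnm1E eqxx //.
  by rewrite addn1.
exists (U_(i) + U_(j))%MM; first by exists i, j.
apply/mnm_lepP => l; rewrite mnmDE !mnm1E.
have [<-|_] := eqVneq i l; last by have [<-|_] := eqVneq j l.
by have [ji|_] := eqVneq j i; first by rewrite ji e_irr in ij.
Qed.

Lemma vertex_coverP C i j : vertex_cover C -> e i j -> (i \in C) || (j \in C).
Proof. by move=> /forallP/(_ i)/forallP/(_ j)/implyP; apply. Qed.

(** In an inclusion-minimal cover inside C, a vertex with all its neighbours in the cover could be
    removed. *)
Lemma minimal_cover C : vertex_cover C -> exists C',
  [/\ vertex_cover C', C' \subset C &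
      forall i, i \in C' -> exists2 j, e i j & j \notin C'].
Proof.
move=> /minset_exists[C' minC sub]; exists C'; split=> //; first exact: minsetp minC.
have cC := minsetp minC.
move=> i iC; apply: contrapT => nb.
have cov : vertex_cover (C' :\ i).
  apply/forallP => x; apply/forallP => y; apply/implyP => xy.
  have := vertex_coverP cC xy; rewrite !inE.
  have [xi|_] := eqVneq x i; last first.
    have [yi|_] //= := eqVneq y i; case: (boolP (x \in C')) => //= xC _.
    by case: nb; exists x => //; rewrite -yi e_sym.
  have [yi|_ _] /= := eqVneq y i; first by rewrite xi yi e_irr in xy.
  by apply: contrapT => /negP yC; case: nb; exists y => //; rewrite -xi.
have /setP/(_ i) := minsetinf minC cov (subD1set _ _).
by rewrite !inE eqxx iC.
Qed.

Lemma wtD C a b : wt C (a + b)%MM = (wt C a + wt C b)%N.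
Proof. by rewrite /wt -big_split; apply: eq_bigr => i _; rewrite mnmDE. Qed.

Lemma wt0 C : wt C 0%MM = 0%N.
Proof. by rewrite /wt big1 // => i _; rewrite mnm0E. Qed.

Lemma wt_le C a b : (a <= b)%MM -> (wt C a <= wt C b)%N.
Proof. by move=> /mnm_lepP ab; apply: leq_sum. Qed.

Lemma wt_sub C C' a : C' \subset C -> (wt C' a <= wt C a)%N.
Proof.
move=> sub; rewrite /wt [leqRHS](big_setID C') /= (finset.setIidPr sub).
exact: leq_addr.
Qed.

Lemma wt_gt0P C a : (0 < wt C a)%N <-> exists2 i, i \in C & (0 < a i)%N.
Proof.
split=> [|[i iC ai]].
  by rewrite lt0n sum_nat_eq0 negb_forall => /existsP[i]; rewrite negb_imply -lt0n => /andP[]; exists i.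
by rewrite /wt (bigD1 i) //= addn_gt0 ai.
Qed.

(** * Weight orders and the primes of minimal covers *)

Definition wt_ge C m : set 'X_{1..n} := [set a | (m <= wt C a)%N].

Lemma wt_ge_up C m : upset (wt_ge C m).
Proof. by move=> a b Ca ab; apply: leq_trans Ca _; apply: wt_le. Qed.

(* The substitution X_i -> X_i t for i in C turns the weight order into the
   t-adic order. *)
Definition wt_expand C : R -> {poly R} :=
  mmap (polyC \o @mpolyC n k) (fun i => ('X_i)%:P * 'X^(i \in C)).

Lemma wt_expandM C : {morph wt_expand C : f g / f * g}.
Proof. by move=> f g; rewrite /wt_expand rmorphM. Qed.

Lemma wt_expand_coef C f j b :
  ((wt_expand C f)`_j)@_b = if wt C b == j then f@_b else 0.
Proof.
have mm a : mmap1 (fun i => ('X_i : R)%:P * 'X^(i \in C)) a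
    = ('X_[a])%:P * 'X^(wt C a).
  rewrite /mmap1 (eq_bigr (fun i => ('X_i ^+ a i)%:P * 'X^((i \in C) * a i))).
    rewrite big_split /= -rmorph_prod -mpolyXE_id; congr (_ * _).
    rewrite /wt prodrXr; congr ('X^_); rewrite [RHS]big_mkcond; apply: eq_bigr => i _.
    by case: (i \in C); rewrite ?mul1n ?mul0n.
  by move=> i _; rewrite exprMn rmorphXn /= exprM.
transitivity (\sum_(a <- msupp f)
    if wt C b == j then (f@_a *: ('X_[a] : R))@_b else 0); last first.
  case: ifP => _; last by rewrite big1.
  by rewrite [in RHS](mpolyE f) [RHS]raddf_sum.
rewrite /wt_expand /mmap coef_sum [LHS]raddf_sum.
apply: eq_bigr => a _; rewrite mm /= mulrA -polyCM coefCM coefXn mul_mpolyC.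
rewrite mulr_natr mcoeffMn mcoeffZ mcoeffX.
have [->|_] := eqVneq a b; last by rewrite mulr0 mul0rn if_same.
by rewrite mulr1 eq_sym; case: eqP.
Qed.

Lemma mspan_wt_geP C m f :
  mspan k (wt_ge C m) f <-> forall j, (j < m)%N -> (wt_expand C f)`_j = 0.
Proof.
split=> [Cf j jm|H a].
  apply/mpolyP => b; rewrite wt_expand_coef mcoeff0; case: eqP => // wb.
  by apply: memN_msupp_eq0; apply/negP => /Cf; rewrite /wt_ge /= wb leqNgt jm.
rewrite mcoeff_msupp /wt_ge /= leqNgt => fa; apply/negP => /H /(congr1 (mcoeff a)).
by rewrite wt_expand_coef eqxx mcoeff0; apply/eqP.
Qed.

(** [mspan k (wt_ge C m)] is the m-th power of the prime generated by the variables of C, and this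
    is its primary property: an s outside the prime has a nonzero constant term in t after the
    substitution. *)
Lemma mspan_wt_ge_cancel C m s f : ~ mspan k (wt_ge C 1) s ->
  mspan k (wt_ge C m) (s * f) -> mspan k (wt_ge C m) f.
Proof.
move=> s0 /mspan_wt_geP; rewrite wt_expandM => H; apply/mspan_wt_geP.
have {}s0 : (wt_expand C s)`_0 != 0.
  by apply/eqP => s00; apply: s0; apply/mspan_wt_geP => -[].
exact: low_coef_cancel s0 H.
Qed.

Lemma mspan_wt_ge_prime C : prime_ideal (mspan k (wt_ge C 1)).
Proof.
apply/prime_idealP; split.
- exact/mspan_ideal/wt_ge_up.
- by rewrite -[1](mpolyX0 n k) => /mspanX; rewrite /wt_ge /= wt0.
- move=> f g fg; have [Cf|Cf] := pselect (mspan k (wt_ge C 1) f); [by left|right].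
  exact: mspan_wt_ge_cancel Cf fg.
Qed.

Definition complement_mnm C : 'X_{1..n} := [multinom (i \notin C : nat) | i < n].

(** The prime is the annihilator of the product of all variables outside C: each vertex of C has a
    neighbour there, while no edge lies entirely there. *)
Lemma minimal_cover_Ass C : vertex_cover C ->
  (forall i, i \in C -> exists2 j, e i j & j \notin C) ->
  Ass (mspan k E1) (mspan k (wt_ge C 1)).
Proof.
move=> cC minC; split; first exact: mspan_wt_ge_prime.
exists 'X_[complement_mnm C]; apply/seteqP; split=> f.
  move=> Cf a; rewrite (perm_mem (msuppMX _ _)) => /mapP[b /Cf /wt_gt0P[i iC bi] ->].
  have [j ij jC] := minC i iC; apply/upclose_edgeP; exists i, j; split=> //.
    by rewrite mnmDE; lia.
  by rewrite mnmDE mnmE jC.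
move=> Jf a af; apply/wt_gt0P.
have /upclose_edgeP[i [j [ij]]] : E1 (complement_mnm C + a)%MM.
  by apply: Jf; rewrite (perm_mem (msuppMX _ _)); apply: map_f.
rewrite !mnmDE !mnmE; have := vertex_coverP cC ij.
case: (boolP (i \in C)) => iC /=; first by move=> _ ai _; exists i.
by move=> jC _ aj; exists j; rewrite // jC in aj *.
Qed.

Lemma mpow_edge_wt C m a : vertex_cover C -> mpow E1 m a -> (m <= wt C a)%N.
Proof.
move=> cC; elim: m a => // m IH _ [b [c [/upclose_edgeP[i [j [ij bi bj]]] /IH mc ->]]].
rewrite wtD -add1n leq_add //; apply/wt_gt0P.
by case/orP: (vertex_coverP cC ij); [exists i|exists j].
Qed.

(* Pair each vertex of C occurring in a with a neighbour outside of C. *)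
Lemma mpow_edge_complement C m N a :
  (forall i, i \in C -> exists2 j, e i j & j \notin C) ->
  (m <= wt C a)%N -> (m <= N)%N -> mpow E1 m (complement_mnm C *+ N + a)%MM.
Proof.
move=> nb; elim: m N a => // m IH [//|N] a mw mN.
have /wt_gt0P[i iC ai] : (0 < wt C a)%N by apply: leq_trans mw.
have [j ij jC] := nb i iC.
have Ua : (U_(i) <= a)%MM by rewrite lep1mP; lia.
have Uc : (U_(j) <= complement_mnm C)%MM by rewrite lep1mP mnmE jC.
exists (U_(i) + U_(j))%MM, (complement_mnm C *+ N + (a - U_(i)) + (complement_mnm C - U_(j)))%MM.
split.
- by exists (U_(i) + U_(j))%MM; [exists i, j|apply: lepm_refl].
- apply: (@mpow_up _ _ m) (lem_addr _ _); apply: IH => //.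
  have := wtD C (a - U_(i))%MM U_(i)%MM; rewrite submK // => wa.
  suff : wt C U_(i)%MM = 1%N by lia.
  rewrite /wt (bigD1 i) //= mnm1E eqxx big1 // => l /andP[_ li].
  by rewrite mnm1E eq_sym (negbTE li).
- apply/mnmP => l; rewrite !mnmDE !mnmBE !mulmnE.
  move/mnm_lepP: Ua => /(_ l); move/mnm_lepP: Uc => /(_ l).
  by move: (U_(i)%MM l) (U_(j)%MM l) (complement_mnm C l) (a l); lia.
Qed.

(** Let p be the annihilator of the class of g, and X^b a monomial of g outside the ideal. For i in
    C an edge divides X_i X^b, so i has a neighbour j with b_j > 0. Such a j is not in C, since X_j
    X^b has the same support as X^b. *)
Lemma Ass_edge_cover p : Ass (mspan k E1) p ->
  let C := finset (fun i => `[< p 'X_i >]) in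
  vertex_cover C /\ forall i, i \in C -> exists2 j, e i j & j \notin C.
Proof.
move=> [/prime_idealP[_ p1 pp] [g pE]] C.
have Cp i : i \in C <-> p 'X_i by rewrite inE; split=> /asboolP.
have iJ : is_ideal (mspan k E1) by apply/mspan_ideal/upclose_up.
split.
  apply/forallP => i; apply/forallP => j; apply/implyP => ij.
  have : p ('X_i * 'X_j).
    have [_ _ JM] := iJ; rewrite pE /= mulrC; apply: JM; rewrite -mpolyXD.
    by apply/mspanX; exists (U_(i) + U_(j))%MM; [exists i, j|apply: lepm_refl].
  by case/pp => /Cp ->; rewrite ?orbT.
have [b bg Eb] : exists2 b, b \in msupp g & ~ E1 b.
  apply: contrapT => nb; apply: p1; rewrite pE /= mul1r => b bg.
  by apply: contrapT => Eb; apply: nb; exists b.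
have nbr i : i \in C -> E1 (U_(i) + b)%MM.
  move=> /Cp; rewrite pE /= mulrC; apply.
  by rewrite (perm_mem (msuppMX _ _)); apply: map_f.
move=> i iC; have [j ij bj] : exists2 j, e i j & (0 < b j)%N.
  have /upclose_edgeP[x [y [xy]]] := nbr i iC; rewrite !mnmDE !mnm1E.
  have [xi|_] := eqVneq i x; have [yi|_] := eqVneq i y => /= bx by'.
  - by rewrite -xi -yi e_irr in xy.
  - by exists y => //; rewrite xi.
  - by exists x => //; rewrite yi e_sym.
  - by case: Eb; apply/upclose_edgeP; exists x, y.
exists j => //; apply/negP => /nbr /upclose_edgeP[x [y [xy]]].
rewrite !mnmDE !mnm1E => bx by'; apply: Eb; apply/upclose_edgeP; exists x, y.
split=> //.
  by have [jx|jx] := eqVneq j x; [rewrite -jx|rewrite (negbTE jx) in bx].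
by have [jy|jy] := eqVneq j y; [rewrite -jy|rewrite (negbTE jy) in by'].
Qed.

Theorem symbolic_power_edge_ideal m :
  symbolic_power (edge_ideal e (fun i => 'X_i : R)) m = mspan k (sym_set m).
Proof.
rewrite edge_ideal_mspan /symbolic_power.
case: m => [|m]; first by apply/seteqP; split.
have iJ : is_ideal (mspan k (mpow E1 m.+1)) by apply/mspan_ideal/mpow_up.
apply/seteqP; split=> f.
  (* It suffices to bound the weight on a minimal cover inside C, whose prime is associated. *)
  move=> Jf a af C /minimal_cover[C' [cC' sub minC']].
  apply: leq_trans (wt_sub a sub); move: a af.
  have := Jf _ (minimal_cover_Ass cC' minC'); rewrite /mkset ideal_pow_mspan.
  move=> /(extensionP _ (mspan_wt_ge_prime C') iJ)[s Cs sf].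
  apply: mspan_wt_ge_cancel Cs _ => a /sf; exact: mpow_edge_wt.
move=> Sf p Jp; have [cC nb] := Ass_edge_cover Jp.
set C := finset _ in cC nb.
have pp := Jp.1; rewrite /mkset ideal_pow_mspan; apply/(extensionP _ pp iJ).
have [_ p1 pM] := (prime_idealP p).1 pp.
(* A product of variables outside p is outside p. The exponent [msize f] exceeds the degree of every
   monomial of f, hence m, which leaves enough outer neighbours to form m edges. *)
exists ('X_[complement_mnm C *+ msize f]).
  rewrite mpolyXE_id; apply: (big_ind (fun x => ~ p x)) => //.
    by move=> x y px py /pM[].
  move=> i _; rewrite mulmnE mnmE; case: (boolP (i \in C)) => [_|iC] //=.
  rewrite mul1n; elim: (msize f) => [//|N IH]; rewrite exprS => /pM[|//].
  by move=> pi; move: iC; rewrite inE; case: asboolP.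
move=> a; rewrite mulrC (perm_mem (msuppMX _ _)) => /mapP[b bf ->].
apply: mpow_edge_complement => //; first exact: Sf.
apply: leq_trans (Sf _ bf _ cC) _; apply: leq_trans (ltnW (msize_mdeg_lt bf)).
by rewrite mdegE /wt [leqRHS](bigID (mem C)) /= leq_addr.
Qed.

End SymbolicPowers.

(** * The cycles of length 11, 19 and 29 *)

Section ThreeCycles.
Local Open Scope nat_scope.
Local Notation V := 'I_(11 + 19 + 29).
Implicit Types (a b : 'X_{1..11 + 19 + 29}) (v : V).

Definition xv (i : 'I_11) : V := lshift 29 (lshift 19 i).
Definition yv (j : 'I_19) : V := lshift 29 (rshift 11 j).
Definition zv (l : 'I_29) : V := rshift (11 + 19) l.

(** The vertices 0 to 10, 11 to 29 and 30 to 58 carry the x, y and z variables. *)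
Definition next_vertex (v : nat) : nat :=
  if v == 10 then 0 else if v == 29 then 11 else if v == 58 then 30 else v.+1.

Definition prev_vertex (v : nat) : nat :=
  if v == 0 then 10 else if v == 11 then 29 else if v == 30 then 58 else v.-1.

Definition three_cycles : rel V := fun i j => (next_vertex i == j) || (next_vertex j == i).

Definition nextv (v : V) : V := @inord 58 (next_vertex v).
Definition prevv (v : V) : V := @inord 58 (prev_vertex v).

Lemma val_nextv v : nextv v = next_vertex v :> nat.
Proof. by rewrite inordK // /next_vertex; have := ltn_ord v; do !case: eqP; lia. Qed.

Lemma val_prevv v : prevv v = prev_vertex v :> nat.
Proof. by rewrite inordK // /prev_vertex; have := ltn_ord v; do !case: eqP; lia. Qed.

Lemma prevvK v : nextv (prevv v) = v.
Proof.
apply: val_inj => /=; rewrite val_nextv val_prevv /next_vertex /prev_vertex.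
by have := ltn_ord v; do !case: eqP; lia.
Qed.

Lemma nextvK v : prevv (nextv v) = v.
Proof.
apply: val_inj => /=; rewrite val_prevv val_nextv /next_vertex /prev_vertex.
by have := ltn_ord v; do !case: eqP; lia.
Qed.

Lemma nextv_xv i : nextv (xv i) = xv (ordS i).
Proof.
apply: val_inj => /=; rewrite val_nextv /next_vertex /=.
by have := ltn_ord i; do !case: eqP; lia.
Qed.

Lemma nextv_yv j : nextv (yv j) = yv (ordS j).
Proof.
apply: val_inj => /=; rewrite val_nextv /next_vertex /=.
by have := ltn_ord j; do !case: eqP; lia.
Qed.

Lemma nextv_zv l : nextv (zv l) = zv (ordS l).
Proof.
apply: val_inj => /=; rewrite val_nextv /next_vertex /=.
by have := ltn_ord l; do !case: eqP; lia.
Qed.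

Lemma prevv_xv i : prevv (xv i) = xv (ord_pred i).
Proof. by rewrite -{1}[i]ord_predK -nextv_xv nextvK. Qed.

Lemma prevv_yv j : prevv (yv j) = yv (ord_pred j).
Proof. by rewrite -{1}[j]ord_predK -nextv_yv nextvK. Qed.

Lemma prevv_zv l : prevv (zv l) = zv (ord_pred l).
Proof. by rewrite -{1}[l]ord_predK -nextv_zv nextvK. Qed.

Variant vertex_spec : V -> Type :=
  | VertexX i : vertex_spec (xv i)
  | VertexY j : vertex_spec (yv j)
  | VertexZ l : vertex_spec (zv l).

Lemma vertexP v : vertex_spec v.
Proof.
case: (split_ordP v) => [w ->|l ->]; last exact: VertexZ.
by case: (split_ordP w) => [i ->|j ->]; [exact: VertexX|exact: VertexY].
Qed.

Lemma three_cycles_sym : ssrbool.symmetric three_cycles.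
Proof. by move=> i j; rewrite /three_cycles orbC. Qed.

Lemma three_cycles_irr : irreflexive three_cycles.
Proof. by move=> i; rewrite /three_cycles orbb /next_vertex; do !case: eqP; lia. Qed.

Lemma three_cyclesP i j : three_cycles i j = (nextv i == j) || (nextv j == i).
Proof. by rewrite /three_cycles -!val_nextv. Qed.

Lemma sum_vertices (F : V -> nat) : \sum_v F v =
  \sum_(i < 11) F (xv i) + \sum_(j < 19) F (yv j) + \sum_(l < 29) F (zv l).
Proof. by rewrite !big_split_ord. Qed.

Definition edgem (v : V) : 'X_{1..11 + 19 + 29} := (U_(v) + U_(nextv v))%MM.

Lemma edgem_edge v : edge_mnm three_cycles (edgem v).
Proof. by exists v, (nextv v); split=> //; rewrite three_cyclesP eqxx. Qed.

Lemma edge_edgem a : edge_mnm three_cycles a -> exists v, a = edgem v.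
Proof.
move=> [i [j [+ ->]]]; rewrite three_cyclesP => /orP[] /eqP <-; first by exists i.
by exists j; rewrite addmC.
Qed.

(** * Products of edges and of the monomials w1, w2, w3 *)

Fixpoint edge_sum (n : nat) b : Prop :=
  if n is m.+1 then exists v c, edge_sum m c /\ b = (edgem v + c)%MM else b = 0%MM.

Lemma edge_sumD m n b c : edge_sum m b -> edge_sum n c -> edge_sum (m + n) (b + c)%MM.
Proof.
elim: m b => [|m IH] b /=; first by move=> ->; rewrite add0m.
move=> [v [b' [sb ->]]] sc; exists v, (b' + c)%MM; split; first exact: IH.
by rewrite addmA.
Qed.

Lemma edge_sum_split m n b : edge_sum (m + n) b ->
  exists c d, [/\ edge_sum m c, edge_sum n d & b = (c + d)%MM].
Proof.
elim: m b => [|m IH] b /=; first by move=> sb; exists 0%MM, b; rewrite add0m.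
move=> [v [b' [/IH[c [d [sc sd ->]]] ->]]].
by exists (edgem v + c)%MM, d; split=> //; [exists v, c|rewrite addmA].
Qed.

Lemma edge_sum_mdeg n b : edge_sum n b -> mdeg b = 2 * n.
Proof.
elim: n b => [|n IH] b /=; first by move=> ->; rewrite mdeg0.
move=> [v [c [/IH dc ->]]]; rewrite !mdegD !mdeg1 dc; lia.
Qed.

(** [y v] is the multiplicity of the edge from v to its successor; a vertex meets only this edge and
    the one from its predecessor. *)
Lemma edge_sum_weights (y : V -> nat) :
  edge_sum (\sum_v y v) [multinom y v + y (prevv v) | v < 11 + 19 + 29].
Proof.
have -> : [multinom y v + y (prevv v) | v < 11 + 19 + 29] =
    (\sum_v edgem v *+ y v)%MM.
  apply/mnmP => u; rewrite mnmE mnm_sumE.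
  under eq_bigr => v _ do rewrite mulmnE mnmDE !mnm1E mulnDl.
  rewrite big_split /= (bigD1 u) //= eqxx mul1n big1 ?addn0; last first.
    by move=> v /negbTE ->.
  rewrite (bigD1 (prevv u)) //= prevvK eqxx mul1n big1 ?addn0 // => v.
  by move=> vu; case: eqP => // uv; rewrite -uv nextvK eqxx in vu.
apply: (big_ind2 edge_sum) => //= [m b n c|v _]; first exact: edge_sumD.
elim: (y v) => [//|n IH]; rewrite mulmS.
by exists v, (edgem v *+ n)%MM.
Qed.

Definition W1 : 'X_{1..11 + 19 + 29} := [multinom (v < 11 : nat) | v < 11 + 19 + 29].
Definition W2 : 'X_{1..11 + 19 + 29} := [multinom (11 <= v < 30 : nat) | v < 11 + 19 + 29].
Definition W3 : 'X_{1..11 + 19 + 29} := [multinom (30 <= v : nat) | v < 11 + 19 + 29].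

Lemma W1E : (forall i, W1 (xv i) = 1) * (forall j, W1 (yv j) = 0) *
  (forall l, W1 (zv l) = 0).
Proof. by split; [split|] => i; rewrite mnmE /=; have := ltn_ord i; lia. Qed.

Lemma W2E : (forall i, W2 (xv i) = 0) * (forall j, W2 (yv j) = 1) *
  (forall l, W2 (zv l) = 0).
Proof. by split; [split|] => i; rewrite mnmE /=; have := ltn_ord i; lia. Qed.

Lemma W3E : (forall i, W3 (xv i) = 0) * (forall j, W3 (yv j) = 0) *
  (forall l, W3 (zv l) = 1).
Proof. by split; [split|] => i; rewrite mnmE /=; have := ltn_ord i; lia. Qed.

Lemma mdeg_W1 : mdeg W1 = 11.
Proof.
rewrite mdegE sum_vertices.
transitivity (\sum_(i < 11) 1 + \sum_(j < 19) 0 + \sum_(l < 29) 0).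
  by congr (_ + _ + _); apply: eq_bigr => i _; rewrite W1E.
by rewrite !sum_nat_const !card_ord.
Qed.

Lemma mdeg_W2 : mdeg W2 = 19.
Proof.
rewrite mdegE sum_vertices.
transitivity (\sum_(i < 11) 0 + \sum_(j < 19) 1 + \sum_(l < 29) 0).
  by congr (_ + _ + _); apply: eq_bigr => i _; rewrite W2E.
by rewrite !sum_nat_const !card_ord.
Qed.

Lemma mdeg_W3 : mdeg W3 = 29.
Proof.
rewrite mdegE sum_vertices.
transitivity (\sum_(i < 11) 0 + \sum_(j < 19) 0 + \sum_(l < 29) 1).
  by congr (_ + _ + _); apply: eq_bigr => i _; rewrite W3E.
by rewrite !sum_nat_const !card_ord.
Qed.

Definition decomp E A B C a : Prop :=
  exists2 b, edge_sum E b & (b + W1 *+ A + W2 *+ B + W3 *+ C <= a)%MM.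

Definition value E A B C := E + 6 * A + 10 * B + 15 * C.

(** A cover has weight at least 1 on each edge. As w1^2 is the product of the 11 edges of its cycle,
    twice the weight of w1 is at least 11, so the weight is at least 6; likewise 10 and 15. *)
Lemma decomp_sym E A B C a : decomp E A B C a ->
  sym_set three_cycles (value E A B C) a.
Proof.
move=> [b sb le] K cK; apply: leq_trans (wt_le K le); rewrite !wtD.
have wM c n : wt K (c *+ n)%MM = wt K c * n.
  by elim: n => [|n IH]; rewrite ?mulm0n ?wt0 ?muln0 // mulmS wtD IH mulnS.
have we v : 1 <= wt K (edgem v).
  apply/wt_gt0P; have : three_cycles v (nextv v) by rewrite three_cyclesP eqxx.
  move=> /(vertex_coverP cK)/orP[vK|vK].
    by exists v => //; rewrite mnmDE !mnm1E eqxx.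
  by exists (nextv v) => //; rewrite mnmDE !mnm1E eqxx addn1.
have wsum n c : edge_sum n c -> n <= wt K c.
  elim: n c => // n IH _ [v [c [/IH nc ->]]].
  by rewrite wtD -add1n leq_add // we.
have half (w : 'X_{1..11 + 19 + 29}) (y : V -> nat) :
    (forall v, y v + y (prevv v) <= w v * 2) -> \sum_v y v <= wt K w * 2.
  move=> yw; apply: leq_trans (wsum _ _ (edge_sum_weights y)) _.
  by rewrite -wM; apply: wt_le; apply/mnm_lepP => v; rewrite mnmE mulmnE.
have w1 : 6 <= wt K W1.
  have := half W1 (fun v => W1 v); rewrite -mdegE mdeg_W1 => H; suff : 11 <= wt K W1 * 2 by lia.
  by apply: leq_trans (H _) => // v; case/vertexP: v => i; rewrite ?prevv_xv ?prevv_yv ?prevv_zv !(W1E, W2E, W3E).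
have w2 : 10 <= wt K W2.
  have := half W2 (fun v => W2 v); rewrite -mdegE mdeg_W2 => H; suff : 19 <= wt K W2 * 2 by lia.
  by apply: leq_trans (H _) => // v; case/vertexP: v => i; rewrite ?prevv_xv ?prevv_yv ?prevv_zv !(W1E, W2E, W3E).
have w3 : 15 <= wt K W3.
  have := half W3 (fun v => W3 v); rewrite -mdegE mdeg_W3 => H; suff : 29 <= wt K W3 * 2 by lia.
  by apply: leq_trans (H _) => // v; case/vertexP: v => i; rewrite ?prevv_xv ?prevv_yv ?prevv_zv !(W1E, W2E, W3E).
rewrite !wM /value; have := wsum _ _ sb; nia.
Qed.

(** The covers given by [odd_cycle_duality] on the three cycles unite to a cover, of weight at least
    m and at most the sum of the packings. The lengths are 2 h + 1 for h = 5, 9, 14, and the whole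
    cycles are worth h + 1 = 6, 10, 15. *)
Lemma sym_decomp m a : sym_set three_cycles m a ->
  exists E A B C, decomp E A B C a /\ m <= value E A B C.
Proof.
move=> Sa.
have [B1 [c1 [y1 [cov1 pack1 le1]]]] := @odd_cycle_duality 5 (fun i => a (xv i)).
have [B2 [c2 [y2 [cov2 pack2 le2]]]] := @odd_cycle_duality 9 (fun i => a (yv i)).
have [B3 [c3 [y3 [cov3 pack3 le3]]]] := @odd_cycle_duality 14 (fun i => a (zv i)).
pose glue T (f : 'I_11 -> T) (g : 'I_19 -> T) (h : 'I_29 -> T) (v : V) : T :=
  match split v with
  | inl w => match split w with inl i => f i | inr j => g j end
  | inr l => h l end.
have glx T f g h i : @glue T f g h (xv i) = f i.
  by rewrite /glue (unsplitK (inl _)) (unsplitK (inl _)).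
have gly T f g h j : @glue T f g h (yv j) = g j.
  by rewrite /glue (unsplitK (inl _)) (unsplitK (inr _)).
have glz T f g h l : @glue T f g h (zv l) = h l.
  by rewrite /glue (unsplitK (inr _)).
pose y := glue _ y1 y2 y3.
exists (\sum_v y v), c1, c2, c3; split.
  exists [multinom y v + y (prevv v) | v < 11 + 19 + 29].
    exact: edge_sum_weights.
  apply/mnm_lepP => v; rewrite !mnmDE !mulmnE mnmE.
  case/vertexP: v => i.
  - rewrite prevv_xv /y !glx !(W1E, W2E, W3E); rewrite mul1n !mul0n !addn0 addnC addnA; exact: pack1.
  - rewrite prevv_yv /y !gly !(W1E, W2E, W3E); rewrite mul1n !mul0n !addn0 addnC addnA; exact: pack2.
  - rewrite prevv_zv /y !glz !(W1E, W2E, W3E); rewrite mul1n !mul0n !addn0 addnC addnA; exact: pack3.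
pose K := finset (glue _ B1 B2 B3).
have cK : vertex_cover three_cycles K.
  have cv v : (v \in K) || (nextv v \in K).
    rewrite !inE; case/vertexP: v => i.
    - by rewrite nextv_xv !glx.
    - by rewrite nextv_yv !gly.
    - by rewrite nextv_zv !glz.
  apply/forallP => i; apply/forallP => j; apply/implyP.
  rewrite three_cyclesP => /orP[]/eqP <-; first exact: cv.
  by rewrite orbC cv.
apply: leq_trans (Sa K cK) _.
have wK : wt K a = \sum_v (v \in K) * a v.
  by rewrite /wt big_mkcond; apply: eq_bigr => v _; case: (v \in K); lia.
rewrite wK (sum_vertices (fun v => (v \in K) * a v)) /value (sum_vertices y) /y.
have -> : \sum_(i < 11) (xv i \in K) * a (xv i) = \sum_(i < 11) B1 i * a (xv i).
  by apply: eq_bigr => i _; rewrite inE glx.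
have -> : \sum_(i < 19) (yv i \in K) * a (yv i) = \sum_(i < 19) B2 i * a (yv i).
  by apply: eq_bigr => i _; rewrite inE gly.
have -> : \sum_(i < 29) (zv i \in K) * a (zv i) = \sum_(i < 29) B3 i * a (zv i).
  by apply: eq_bigr => i _; rewrite inE glz.
have -> : \sum_(i < 11) glue _ y1 y2 y3 (xv i) = \sum_(i < 11) y1 i.
  by apply: eq_bigr => i _; rewrite glx.
have -> : \sum_(i < 19) glue _ y1 y2 y3 (yv i) = \sum_(i < 19) y2 i.
  by apply: eq_bigr => i _; rewrite gly.
have -> : \sum_(i < 29) glue _ y1 y2 y3 (zv i) = \sum_(i < 29) y3 i.
  by apply: eq_bigr => i _; rewrite glz.
have {}le1 : \sum_(i < 11) B1 i * a (xv i) <= c1 * 6 + \sum_(i < 11) y1 i := le1.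
have {}le2 : \sum_(i < 19) B2 i * a (yv i) <= c2 * 10 + \sum_(i < 19) y2 i := le2.
have {}le3 : \sum_(i < 29) B3 i * a (zv i) <= c3 * 15 + \sum_(i < 29) y3 i := le3.
apply: leq_trans (leq_add (leq_add le1 le2) le3) _; lia.
Qed.


(** * Degree counts and the Veronese property *)

Definition deg_on m (f : 'I_m -> V) a := \sum_i a (f i).

Lemma deg_onD m (f : 'I_m -> V) a b :
  deg_on f (a + b)%MM = deg_on f a + deg_on f b.
Proof. by rewrite -big_split; apply: eq_bigr => i _; rewrite mnmDE. Qed.

Lemma deg_onMn m (f : 'I_m -> V) a n : deg_on f (a *+ n)%MM = deg_on f a * n.
Proof. by rewrite big_distrl; apply: eq_bigr => i _; rewrite mulmnE. Qed.

Lemma deg_on_le m (f : 'I_m -> V) a b : (a <= b)%MM -> deg_on f a <= deg_on f b.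
Proof. by move=> /mnm_lepP ab; apply: leq_sum. Qed.

Lemma mdeg_le a b : (a <= b)%MM -> mdeg a <= mdeg b.
Proof. by move=> /submK <-; rewrite mdegD leq_addl. Qed.

Lemma deg_on_cst m (f : 'I_m -> V) a n : (forall i, a (f i) = n) ->
  deg_on f a = m * n.
Proof.
move=> af; rewrite /deg_on (eq_bigr (fun=> n)) => [|i _]; last exact: af.
by rewrite sum_nat_const card_ord.
Qed.

Lemma decomp_bounds E A B C a : decomp E A B C a ->
  [/\ 2 * E + 11 * A + 19 * B + 29 * C <= mdeg a, 11 * A <= deg_on xv a,
      19 * B <= deg_on yv a & 29 * C <= deg_on zv a].
Proof.
move=> [b sb le]; split.
- by apply: leq_trans (mdeg_le le); rewrite !mdegD !mdegMn mdeg_W1 mdeg_W2 mdeg_W3 (edge_sum_mdeg sb).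
- apply: leq_trans (deg_on_le xv le); rewrite !deg_onD !deg_onMn.
  by rewrite (@deg_on_cst _ xv W1 1) ?W1E // => [|i]; rewrite ?W1E //; lia.
- apply: leq_trans (deg_on_le yv le); rewrite !deg_onD !deg_onMn.
  by rewrite (@deg_on_cst _ yv W2 1) => [|i]; rewrite ?W2E //; lia.
- apply: leq_trans (deg_on_le zv le); rewrite !deg_onD !deg_onMn.
  by rewrite (@deg_on_cst _ zv W3 1) => [|i]; rewrite ?W3E //; lia.
Qed.

Local Notation sym := (sym_set three_cycles).

Lemma sym_up d : upset (sym d).
Proof. by move=> a b Sa ab K cK; apply: leq_trans (Sa K cK) _; apply: wt_le. Qed.

Lemma symD c d a b : sym c a -> sym d b -> sym (c + d) (a + b)%MM.
Proof. by move=> Sa Sb K cK; rewrite wtD leq_add // ?Sa ?Sb. Qed.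

Lemma mpow_sym d k : mpow (sym d) k `<=` sym (d * k).
Proof.
elim: k => [|k IH] a; first by move=> _ K _; rewrite muln0.
by move=> [b [c [Sb /IH Sc ->]]]; rewrite mulnS; apply: symD.
Qed.

Lemma decomp_split E A B C E' A' B' C' a :
  decomp (E + E') (A + A') (B + B') (C + C') a ->
  exists b c, [/\ decomp E A B C b, decomp E' A' B' C' c & a = (b + c)%MM].
Proof.
move=> [_ /edge_sum_split[b [c [sb sc ->]]] le].
set b' := (b + W1 *+ A + W2 *+ B + W3 *+ C)%MM.
set c' := (c + W1 *+ A' + W2 *+ B' + W3 *+ C')%MM.
have {}le : (b' + c' <= a)%MM.
  apply: lepm_trans le; apply/mnm_lepP => v; rewrite !mnmDE !mulmnE; lia.
exists b', (a - b')%MM; split.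
- by exists b => //; apply: lepm_refl.
- exists c => //; apply/mnm_lepP => v; rewrite mnmBE -/c'.
  by move/mnm_lepP: le => /(_ v); rewrite mnmDE; lia.
- by rewrite addmC submK //; apply: lepm_trans le; apply: lem_addr.
Qed.

(* A multiset of parts 1, 6, 10, 15 of sum at least 120 contains two of the
   blocks 30 * 1, 5 * 6, 3 * 10, 2 * 15, because without blocks the sum is at
   most 29 + 24 + 20 + 15 = 88. *)
Lemma value_split E A B C : 120 <= value E A B C -> exists E' A' B' C',
  [/\ E' <= E, A' <= A, B' <= B, C' <= C & value E' A' B' C' = 60].
Proof.
rewrite /value => ge.
(* Blocks are taken in the order of the parts 1, 6, 10, 15 until there are two; after one block at
   least 90 > 88 remains, so a second exists. *)
pose e := minn (E %/ 30) 2; pose i := minn (A %/ 5) (2 - e).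
pose j := minn (B %/ 3) (2 - e - i).
exists (30 * e), (5 * i), (3 * j), (2 * (2 - e - i - j)).
rewrite /e /i /j; split; lia.
Qed.

(** By induction: a factor of value exactly 60 is split off, and the cofactor keeps all of the
    remaining value. *)
Lemma sym_60 k : 0 < k -> sym (60 * k) = mpow (sym 60) k.
Proof.
case: k => // k _; apply/seteqP; split; last exact: mpow_sym.
elim: k => [|k IH] a Sa.
  by exists a, 0%MM; split; rewrite ?addm0.
have [E [A [B [C [dec ge]]]]] := sym_decomp Sa.
have [] := @value_split E A B C; first by apply: leq_trans ge; lia.
move=> E' [A' [B' [C' [lE lA lB lC v60]]]].
move: dec; rewrite -(subnKC lE) -(subnKC lA) -(subnKC lB) -(subnKC lC).
move=> /decomp_split[b [c [/decomp_sym Sb /decomp_sym Sc ->]]].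
exists b, c; split=> //; first by rewrite -v60.
apply: IH => K cK; apply: leq_trans (Sc K cK).
by move: ge v60; rewrite /value; lia.
Qed.

Lemma mpow_mdeg (S : set 'X_{1..11 + 19 + 29}) L a k c :
  (forall b, S b -> (b <= a)%MM -> L <= mdeg b) ->
  mpow S k c -> (c <= a)%MM -> k * L <= mdeg c.
Proof.
move=> SL; elim: k c => [//|k IH] _ [b [c [Sb Sc ->]]] le.
rewrite mdegD mulSn leq_add //.
  by apply: SL => //; apply: lepm_trans le; apply: lem_addr.
by apply: IH => //; apply: lepm_trans le; apply: lem_addl.
Qed.

(* Compare degrees: an element of [sym d] dividing a power of [Wi] has degree
   at least [2 * d - d %/ v], where [v] is the value of [Wi], whereas [Wi *+ d]
   has degree [(2 * v - 1) * d]. *)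
Lemma standard_dvd30 d : (forall k, 0 < k -> sym (d * k) = mpow (sym d) k) ->
  30 %| d.
Proof.
move=> std.
have deg0 (n : nat) (f : 'I_n -> V) (w b : 'X_{1..11 + 19 + 29}) : (forall i, w (f i) = 0) ->
    (b <= w *+ d)%MM -> deg_on f b = 0.
  move=> wf /(deg_on_le f); rewrite deg_onMn (deg_on_cst wf); lia.
have H6 : 6 * (2 * d - d %/ 6) <= 11 * d.
  rewrite -mdeg_W1 -mdegMn; apply: (@mpow_mdeg (sym d)) (lepm_refl _).
    (* [b] involves only the first cycle, so B = C = 0; under E + 6 A >= d the degree 2 E + 11 A is
       least for A = d %/ 6. *)
    move=> b /sym_decomp[E [A [B [C [dec ge]]]]] le.
    have := decomp_bounds dec.
    rewrite (deg0 _ yv W1) ?(deg0 _ zv W1) // => [[]|i|i]; rewrite ?W1E //.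
    by move: ge; rewrite /value; lia.
  rewrite -std // (_ : d * 6 = value 0 d 0 0); last by rewrite /value; lia.
  apply: decomp_sym.
  by exists 0%MM => //; rewrite add0m !mulm0n !addm0 lepm_refl.
have H10 : 10 * (2 * d - d %/ 10) <= 19 * d.
  rewrite -mdeg_W2 -mdegMn; apply: (@mpow_mdeg (sym d)) (lepm_refl _).
    move=> b /sym_decomp[E [A [B [C [dec ge]]]]] le.
    have := decomp_bounds dec.
    rewrite (deg0 _ xv W2) ?(deg0 _ zv W2) // => [[]|i|i]; rewrite ?W2E //.
    by move: ge; rewrite /value; lia.
  rewrite -std // (_ : d * 10 = value 0 0 d 0); last by rewrite /value; lia.
  apply: decomp_sym.
  by exists 0%MM => //; rewrite add0m !mulm0n !addm0 add0m lepm_refl.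
have H15 : 15 * (2 * d - d %/ 15) <= 29 * d.
  rewrite -mdeg_W3 -mdegMn; apply: (@mpow_mdeg (sym d)) (lepm_refl _).
    move=> b /sym_decomp[E [A [B [C [dec ge]]]]] le.
    have := decomp_bounds dec.
    rewrite (deg0 _ xv W3) ?(deg0 _ yv W3) // => [[]|i|i]; rewrite ?W3E //.
    by move: ge; rewrite /value; lia.
  rewrite -std // (_ : d * 15 = value 0 0 0 d); last by rewrite /value; lia.
  apply: decomp_sym.
  by exists 0%MM => //; rewrite add0m !mulm0n !add0m lepm_refl.
(* [H6] amounts to d <= 6 (d %/ 6), that is, 6 divides d; [H10] and [H15] give 10 and 15 in the same
   way. *)
lia.
Qed.

(* [w1^4 w2^2 w3] times an edge of the first cycle has value 24 + 20 + 15 + 1,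
   and no subfamily of these parts has value 30. *)
Lemma not_standard_30 : sym (30 * 2) <> mpow (sym 30) 2.
Proof.
move=> std.
pose a := (edgem (xv ord0) + W1 *+ 4 + W2 *+ 2 + W3 *+ 1)%MM.
have deca : decomp 1 4 2 1 a.
  exists (edgem (xv ord0)); last exact: lepm_refl.
  by exists (xv ord0), 0%MM; rewrite addm0.
have : mpow (sym 30) 2 a by rewrite -std; apply: (decomp_sym deca).
move=> [b [_ [Sb [c [t [Sc _ ->]]] abc]]].
have [E [A [B [C [/decomp_bounds[d1 d2 d3 d4] ge]]]]] := sym_decomp Sb.
have [E' [A' [B' [C' [/decomp_bounds[d1' d2' d3' d4'] ge']]]]] := sym_decomp Sc.
have ax : deg_on xv a = 46.
  rewrite !deg_onD !deg_onMn (@deg_on_cst _ xv W1 1) ?(@deg_on_cst _ xv W2 0)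
    ?(@deg_on_cst _ xv W3 0) // => [|i|i|i]; rewrite ?W1E ?W2E ?W3E //.
  by rewrite nextv_xv /deg_on !big_ord_recl !big_ord0 !mnm1E.
have au (m : nat) (f : 'I_m -> V) i : (forall j, 11 <= f j) ->
    deg_on f U_(xv i)%MM = 0.
  move=> f11; rewrite (@deg_on_cst _ _ _ 0) ?muln0 // => j.
  rewrite mnm1E; have := f11 j; case: eqP => [<-|//] /=.
  by have := ltn_ord i; lia.
have ay : deg_on yv a = 38.
  rewrite !deg_onD !deg_onMn (@deg_on_cst _ yv W1 0) ?(@deg_on_cst _ yv W2 1)
    ?(@deg_on_cst _ yv W3 0) // => [|i|i|i]; rewrite ?W1E ?W2E ?W3E //.
  by rewrite nextv_xv !au // => i; apply: leq_addr.
have az : deg_on zv a = 29.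
  rewrite !deg_onD !deg_onMn (@deg_on_cst _ zv W1 0) ?(@deg_on_cst _ zv W2 0)
    ?(@deg_on_cst _ zv W3 1) // => [|i|i|i]; rewrite ?W1E ?W2E ?W3E //.
  by rewrite nextv_xv !au // => i; rewrite /=; lia.
have da : mdeg a = 113.
  by rewrite !mdegD !mdegMn mdeg_W1 mdeg_W2 mdeg_W3 !mdeg1.
move: ax ay az da; rewrite abc !deg_onD !mdegD => ax ay az da.
have : A + A' <= 4 /\ B + B' <= 2 /\ C + C' <= 1 by lia.
move: ge ge'; rewrite /value => ge ge' [lA [lB lC]].
have lC2 : C = 0 /\ C' <= 1 \/ C = 1 /\ C' = 0 by lia.
have lB2 : B <= 2 by lia.
have lA2 : A <= 4 by lia.
(* Doubling the values gives 120 <= 113 + (A + A') + (B + B') + (C + C') <= 113 + 7, so equality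
   holds throughout, both values are 30 and E + E' <= 1. The factor with w3 then needs 15 = E + 6 A
   + 10 B with E <= 1, which is impossible. *)
by case: B lB lB2 ge d1 d3 => [|[|[|//]]];
  case: A lA lA2 d2 => [|[|[|[|[|//]]]]]; case: lC2 => -[-> ?]; lia.
Qed.

(** * Decompositions of exact value *)

Definition every_other lo hi (v : V) : nat := (lo <= v < hi) && (odd v == odd lo).

(** Pairing off all vertices but the last of the cycle gives 5 edges, one less than the value 6 of
    w1; the next two lemmas do the same for 10 and 15. *)
Lemma edge_sum_le_W1 : exists2 b, edge_sum 5 b & (b <= W1)%MM.
Proof.
exists [multinom every_other 0 10 v + every_other 0 10 (prevv v) | v < 11 + 19 + 29].
  have := edge_sum_weights (every_other 0 10); congr edge_sum.
  rewrite -(big_mkord xpredT (fun j => (0 <= j < 10) && (odd j == odd 0) : nat)).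
  by rewrite unlock.
apply/mnm_lepP => v; rewrite !mnmE /every_other val_prevv /prev_vertex.
by have := ltn_ord v; do ?[case: ifP => /eqP ?]; lia.
Qed.

Lemma edge_sum_le_W2 : exists2 b, edge_sum 9 b & (b <= W2)%MM.
Proof.
exists [multinom every_other 11 29 v + every_other 11 29 (prevv v) | v < 11 + 19 + 29].
  have := edge_sum_weights (every_other 11 29); congr edge_sum.
  rewrite -(big_mkord xpredT (fun j => (11 <= j < 29) && (odd j == odd 11) : nat)).
  by rewrite unlock.
apply/mnm_lepP => v; rewrite !mnmE /every_other val_prevv /prev_vertex.
by have := ltn_ord v; do ?[case: ifP => /eqP ?]; lia.
Qed.

Lemma edge_sum_le_W3 : exists2 b, edge_sum 14 b & (b <= W3)%MM.
Proof.
exists [multinom every_other 30 58 v + every_other 30 58 (prevv v) | v < 11 + 19 + 29].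
  have := edge_sum_weights (every_other 30 58); congr edge_sum.
  rewrite -(big_mkord xpredT (fun j => (30 <= j < 58) && (odd j == odd 30) : nat)).
  by rewrite unlock.
apply/mnm_lepP => v; rewrite !mnmE /every_other val_prevv /prev_vertex.
by have := ltn_ord v; do ?[case: ifP => /eqP ?]; lia.
Qed.

(** Dropping an edge lowers the value by one; without edges, one w1, w2 or w3 is traded for 5, 9 or
    14 edges. *)
Lemma decomp_pred E A B C a n : decomp E A B C a -> value E A B C = n.+1 ->
  exists E' A' B' C', decomp E' A' B' C' a /\ value E' A' B' C' = n.
Proof.
move=> [b sb le] vn; rewrite /value in vn *.
case: E => [|E] in sb vn; last first.
  exists E, A, B, C; split; last by lia.
  case: sb => v [c [sc bE]]; exists c => //; apply: lepm_trans le.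
  by rewrite bE -![(edgem v + _ + _)%MM]addmA lem_addl.
case: A => [|A] in le vn; last first.
  exists (0 + 5), A, B, C; split; last by lia.
  have [c sc cW] := edge_sum_le_W1; exists (b + c)%MM; first exact: edge_sumD.
  apply: lepm_trans le; apply/mnm_lepP => v; move/mnm_lepP: cW => /(_ v).
  by rewrite !mnmDE !mulmnE; lia.
case: B => [|B] in le vn; last first.
  exists (0 + 9), 0, B, C; split; last by lia.
  have [c sc cW] := edge_sum_le_W2; exists (b + c)%MM; first exact: edge_sumD.
  apply: lepm_trans le; apply/mnm_lepP => v; move/mnm_lepP: cW => /(_ v).
  by rewrite !mnmDE !mulmnE; lia.
case: C => [|C] in le vn; last first.
  exists (0 + 14), 0, 0, C; split; last by lia.
  have [c sc cW] := edge_sum_le_W3; exists (b + c)%MM; first exact: edge_sumD.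
  apply: lepm_trans le; apply/mnm_lepP => v; move/mnm_lepP: cW => /(_ v).
  by rewrite !mnmDE !mulmnE; lia.
by lia.
Qed.

(** Exactness matters for the Rees algebra: X^a t^m has to be a multiple in R of a product of
    generators of total degree exactly m. *)
Lemma sym_decomp_exact m a : sym m a ->
  exists E A B C, decomp E A B C a /\ value E A B C = m.
Proof.
move=> /sym_decomp[E [A [B [C [dec /subnKC]]]]].
move: (_ - m) => n; elim: n E A B C dec => [|n IH] E A B C dec.
  by rewrite addn0 => ->; exists E, A, B, C.
rewrite addnS => vE.
have [E' [A' [B' [C' [dec' vE']]]]] := decomp_pred dec (esym vE).
by apply: IH dec' _; rewrite vE'.
Qed.

End ThreeCycles.

(** * The symbolic Rees algebra *)

Section SubalgebraGenerators.
Variable R : idomainType.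
Implicit Types (A : set {poly R}) (u v : {poly R}).

Lemma subalg_closedP A : GRing.subalg_closed (mem A) <->
  [/\ A 1, forall c u v, A u -> A v -> A (c *: u + v) &
      forall u v, A u -> A v -> A (u * v)].
Proof.
split=> [[/set_mem A1 AL AM]|[A1 AL AM]].
  split=> // [c u v /mem_set Au /mem_set Av|u v /mem_set Au /mem_set Av];
    apply/set_mem; [exact: AL|exact: AM].
split; first exact/mem_set.
  by move=> c u v /set_mem Au /set_mem Av; apply/mem_set; apply: AL.
by move=> u v /set_mem Au /set_mem Av; apply/mem_set; apply: AM.
Qed.

Section Closed.
Variable A : set {poly R}.
Hypothesis clA : GRing.subalg_closed (mem A).

Lemma subalgX u n : A u -> A (u ^+ n).
Proof.
have [A1 _ AM] := (subalg_closedP A).1 clA => Au.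
by elim: n => [|n IH]; rewrite ?expr0 // exprS; apply: AM.
Qed.

Lemma subalg0 : A 0.
Proof.
have [A1 AL _] := (subalg_closedP A).1 clA.
by rewrite -(subrr 1) addrC -scaleN1r; apply: AL.
Qed.

Lemma subalgZ c u : A u -> A (c *: u).
Proof.
have [_ AL _] := (subalg_closedP A).1 clA => Au.
by rewrite -[_ *: _]addr0; apply: AL => //; apply: subalg0.
Qed.

Lemma subalg_sum (T : Type) (r : seq T) (P : pred T) (F : T -> {poly R}) :
  (forall i, P i -> A (F i)) -> A (\sum_(i <- r | P i) F i).
Proof.
have [_ AL _] := (subalg_closedP A).1 clA => AF.
apply: big_ind => //; first exact: subalg0.
by move=> u v Au Av; rewrite -[u]scale1r; apply: AL.
Qed.

End Closed.
End SubalgebraGenerators.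

Section SymbolicRees.
Variable k : fieldType.
Local Notation R := {mpoly k[11 + 19 + 29]}.
Local Notation V := 'I_(11 + 19 + 29).
Local Notation sym := (sym_set three_cycles).
Local Notation J := (edge_ideal three_cycles (fun v => 'X_v : R)).

Lemma symbolic_powerE m : symbolic_power J m = mspan k (sym m).
Proof. exact: (symbolic_power_edge_ideal k three_cycles_sym three_cycles_irr). Qed.

Lemma mspan_sym_ideal m : is_ideal (mspan k (sym m)).
Proof. exact/mspan_ideal/sym_up. Qed.

Lemma symbolic_Rees_closed : GRing.subalg_closed (mem (symbolic_Rees J)).
Proof.
apply/subalg_closedP; split=> [m|c F G SF SG m|F G SF SG m].
- rewrite symbolic_powerE coef1; case: m => [|m] /=; first by move=> a _ K _.
  by have [] := mspan_sym_ideal m.+1.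
- have [_ SD SM] := mspan_sym_ideal m.
  rewrite symbolic_powerE coefD coefZ; apply: SD; first apply: SM.
    by rewrite -symbolic_powerE; apply: SF.
  by rewrite -symbolic_powerE; apply: SG.
- rewrite symbolic_powerE coefM; apply: ideal_sum; first exact: mspan_sym_ideal.
  move=> i _ a /msuppM_le /allpairsP[[b c] /= [bF cG ->]].
  have im : (i + (m - i))%N = m by rewrite subnKC // -ltnS.
  rewrite -im; apply: symD.
    by have := SF i; rewrite symbolic_powerE; apply.
  by have := SG (m - i)%N; rewrite symbolic_powerE; apply.
Qed.

Lemma symbolic_ReesZXn (f : R) m : symbolic_power J m f ->
  symbolic_Rees J (f *: 'X^m).
Proof.
move=> Sf d; rewrite coefZ coefXn; have [->|_] := eqVneq d m.
  by rewrite mulr1.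
by rewrite mulr0 symbolic_powerE; have [] := mspan_sym_ideal d.
Qed.

Lemma symbolic_power_decomp E A B C a : decomp E A B C a ->
  symbolic_power J (value E A B C) 'X_[a].
Proof. by move=> dec; rewrite symbolic_powerE; apply/mspanX/decomp_sym. Qed.

Lemma symbolic_power_edgem v : symbolic_power J 1 ('X_[edgem v]).
Proof.
apply: (@symbolic_power_decomp 1 0 0 0); exists (edgem v).
  by exists v, 0%MM; rewrite addm0.
by rewrite !mulm0n !addm0 lepm_refl.
Qed.

Lemma symbolic_power_W1 : symbolic_power J 6 ('X_[W1]).
Proof.
apply: (@symbolic_power_decomp 0 1 0 0); exists 0%MM => //.
by rewrite add0m !mulm0n !addm0 lepm_refl.
Qed.

Lemma symbolic_power_W2 : symbolic_power J 10 ('X_[W2]).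
Proof.
apply: (@symbolic_power_decomp 0 0 1 0); exists 0%MM => //.
by rewrite add0m !mulm0n !addm0 add0m lepm_refl.
Qed.

Lemma symbolic_power_W3 : symbolic_power J 15 ('X_[W3]).
Proof.
apply: (@symbolic_power_decomp 0 0 0 1); exists 0%MM => //.
by rewrite add0m !mulm0n !add0m lepm_refl.
Qed.

(** F is a sum of scalar multiples of terms X^a t^m, and [sym_decomp_exact] factors each of these
    into generators and an element of R. *)
Lemma symbolic_Rees_sub (A : set {poly R}) : GRing.subalg_closed (mem A) ->
  (forall v, A ('X_[edgem v] *: 'X)) -> A ('X_[W1] *: 'X^6) ->
  A ('X_[W2] *: 'X^10) -> A ('X_[W3] *: 'X^15) -> symbolic_Rees J `<=` A.
Proof.
move=> clA Ae A1 A2 A3 F SF; have [A_1 _ AM] := (subalg_closedP A).1 clA.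
have mulM (a b : 'X_{1..11 + 19 + 29}) m n : ('X_[a] *: 'X^m : {poly R}) * ('X_[b] *: 'X^n)
    = ('X_[(a + b)%MM]) *: 'X^(m + n).
  by rewrite -scalerAl -scalerAr scalerA -mpolyXD -exprD.
have expM (a : 'X_{1..11 + 19 + 29}) m n : ('X_[a] *: 'X^m : {poly R}) ^+ n
    = ('X_[(a *+ n)%MM]) *: 'X^(m * n).
  by rewrite exprZn mpolyXn -exprM.
have AE n b : edge_sum n b -> A ('X_[b] *: 'X^n).
  elim: n b => [|n IH] b /=; first by move=> ->; rewrite mpolyX0 scale1r.
  move=> [v [c [/IH Ac ->]]].
  by have := mulM (edgem v) c 1%N n; rewrite expr1 add1n => <-; apply: AM.
rewrite -[F]coefK poly_def; apply: subalg_sum => // m _.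
have := SF m; rewrite symbolic_powerE => SFm.
rewrite [F`_m]mpolyE scaler_suml big_seq; apply: subalg_sum => // a /SFm.
move=> /sym_decomp_exact[E [B [C [D [[b sb le] <-]]]]].
rewrite -mul_mpolyC -scalerA; apply: subalgZ => //.
rewrite -(submK le) mpolyXD -scalerA; apply: subalgZ => //.
rewrite /value -!mulM -!expM.
by do 3?[apply: (AM)]; try exact: AE; apply: (subalgX clA).
Qed.

(** Finitely many homogeneous generators, one of degree 1 for each edge; the repeated degree 1 is
    why degrees are compared as sets. *)
Definition Rees_gens : seq (nat * R) :=
  [seq (1%N, 'X_[edgem v]) | v : V] ++
  [:: (6%N, 'X_[W1]); (10%N, 'X_[W2]); (15%N, 'X_[W3])].

Lemma Rees_gensP g : g \in Rees_gens ->
  symbolic_power J g.1 g.2 /\ exists a, g.2 = 'X_[a].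
Proof.
rewrite mem_cat !inE => /orP[/mapP[v _ ->]|/or3P[] /eqP->] /=.
- by split; [exact: symbolic_power_edgem|exists (edgem v)].
- by split; [exact: symbolic_power_W1|exists W1].
- by split; [exact: symbolic_power_W2|exists W2].
- by split; [exact: symbolic_power_W3|exists W3].
Qed.

Lemma Rees_gens_degrees : [seq g.1 | g <- Rees_gens] =i [:: 1; 6; 10; 15]%N.
Proof.
move=> d; rewrite map_cat mem_cat !inE -map_comp; congr (_ || _).
apply/mapP/eqP => [[v _ ->] //|->].
by exists ord0; rewrite // mem_enum.
Qed.

Lemma Rees_gens_generate : Rees_generators J Rees_gens.
Proof.
split=> [g gG|].
  have [Sg [a ga]] := Rees_gensP gG; split=> //; last first.
    by rewrite ga -msupp_eq0 msuppX.
  have := Rees_gens_degrees g.1; rewrite (map_f _ gG) !inE => /esym.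
  by case/or4P => /eqP->.
apply/seteqP; split.
  move=> F SF A [clA GA]; apply: symbolic_Rees_sub SF => //.
  - move=> v; apply: GA; exists (1%N, 'X_[edgem v]); last by rewrite expr1.
    by rewrite /= mem_cat (map_f (fun v => (1%N, 'X_[edgem v] : R))) ?mem_enum.
  - by apply: GA; exists (6%N, 'X_[W1]); rewrite //= mem_cat !inE eqxx ?orbT.
  - by apply: GA; exists (10%N, 'X_[W2]); rewrite //= mem_cat !inE eqxx ?orbT.
  - by apply: GA; exists (15%N, 'X_[W3]); rewrite //= mem_cat !inE eqxx ?orbT.
apply: smallest_sub; first exact: symbolic_Rees_closed.
by move=> _ [g /Rees_gensP[Sg _] <-]; apply: symbolic_ReesZXn.
Qed.

Lemma edgem_edge_ideal v : J ('X_[edgem v]).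
Proof.
by rewrite edge_ideal_mspan; apply/mspanX; exists (edgem v);
  [exact: edgem_edge|exact: lepm_refl].
Qed.

Lemma symbolic_power1 : J `<=` symbolic_power J 1.
Proof.
rewrite symbolic_powerE; apply: ideal_gen_sub; first exact: mspan_sym_ideal.
move=> _ [i [j [ij ->]]]; rewrite -mpolyXD; apply/mspanX.
have [v ->] : exists v, (U_(i) + U_(j))%MM = edgem v.
  by apply: edge_edgem; exists i, j.
by have := symbolic_power_edgem v; rewrite symbolic_powerE => /mspanX.
Qed.

Lemma symbolic_Rees_three_cycles : symbolic_Rees J =
  subalg_gen ([set a *: 'X | a in J] `|`
    [set 'X_[W1] *: 'X^6; 'X_[W2] *: 'X^10; 'X_[W3] *: 'X^15]).
Proof.
apply/seteqP; split.
  move=> F SF A [clA GA]; apply: symbolic_Rees_sub SF => //.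
  - by move=> v; apply: GA; left; exists 'X_[edgem v] => //; apply: edgem_edge_ideal.
  - by apply: GA; right; left; left.
  - by apply: GA; right; left; right.
  - by apply: GA; right; right.
apply: smallest_sub; first exact: symbolic_Rees_closed.
move=> _ [[a /symbolic_power1 Ja <-]|[[]|] ->].
- by rewrite -['X]expr1; apply: symbolic_ReesZXn.
- exact/symbolic_ReesZXn/symbolic_power_W1.
- exact/symbolic_ReesZXn/symbolic_power_W2.
- exact/symbolic_ReesZXn/symbolic_power_W3.
Qed.

(** * The standard Veronese degree *)

Lemma svd_setE d : svd_set J d <->
  (0 < d)%N /\ forall m, (0 < m)%N -> sym (d * m) = mpow (sym d) m.
Proof.
split=> -[d0 H]; split=> // m /H; rewrite !symbolic_powerE ideal_pow_mspan.
  exact: mspan_inj.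
by move->.
Qed.

Lemma svd_three_cycles : svd J = Some 60%N.
Proof.
have s60 : svd_set J 60 by apply/svd_setE; split=> // m; exact: sym_60.
rewrite /svd /nat_inf; case: pselect => [ex|]; last first.
  by case; exists 60%N; apply/mem_set.
congr Some; case: ex_minnP => d /set_mem/svd_setE[d0 Hd] dmin.
apply/eqP; rewrite eqn_leq dmin /=; last exact/mem_set.
(* The multiples of 30 below 60 are 0, excluded by d > 0, and 30, excluded by [not_standard_30]. *)
have := standard_dvd30 Hd => /dvdnP[[|[|q]] dE]; rewrite ?dE in d0 *; try lia.
by have := Hd 2; rewrite dE mul1n => /(_ isT) /not_standard_30.
Qed.

End SymbolicRees.

(** * Passage to the variables x, y, z and conclusion *)

Lemma edge_ideal_xyz (k : fieldType) :
  edge_ideal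
    (disjoint_union
       (disjoint_union (@cycle_graph 11) (@cycle_graph 19)) (@cycle_graph 29))
    (@xyz k) =
  edge_ideal three_cycles (fun v => 'X_v : {mpoly k[11 + 19 + 29]}).
Proof.
have cycleX i j : three_cycles (xv i) (xv j) = cycle_graph i j.
  have inj_x : injective xv.
    by move=> ? ? /lshift_inj/lshift_inj.
  rewrite three_cyclesP !nextv_xv /cycle_graph !(inj_eq inj_x).
  by rewrite (eq_sym j) (eq_sym i).
have cycleY i j : three_cycles (yv i) (yv j) = cycle_graph i j.
  have inj_y : injective yv.
    by move=> ? ? /lshift_inj/rshift_inj.
  rewrite three_cyclesP !nextv_yv /cycle_graph !(inj_eq inj_y).
  by rewrite (eq_sym j) (eq_sym i).
have cycleZ i j : three_cycles (zv i) (zv j) = cycle_graph i j.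
  have inj_z : injective zv.
    exact: rshift_inj.
  rewrite three_cyclesP !nextv_zv /cycle_graph !(inj_eq inj_z).
  by rewrite (eq_sym j) (eq_sym i).
pose pos (s : 'I_11 + 'I_19 + 'I_29) :=
  match s with inl (inl i) => xv i | inl (inr j) => yv j | inr l => zv l end.
have posE s : xyz k s = 'X_(pos s) by case: s => [[]|].
have pos_surj v : exists s, v = pos s.
  by case/vertexP: v => i; [exists (inl (inl i))|exists (inl (inr i))|exists (inr i)].
have pos_edge s t : disjoint_union
   (disjoint_union (@cycle_graph 11) (@cycle_graph 19)) (@cycle_graph 29) s t =
   three_cycles (pos s) (pos t).
  case: s t => [[i|i]|i] [[j|j]|j]; rewrite /= ?cycleX ?cycleY ?cycleZ //;
    rewrite three_cyclesP ?nextv_xv ?nextv_yv ?nextv_zv; symmetry;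
    apply/negbTE; rewrite negb_or; apply/andP; split; apply/eqP;
    move=> /(congr1 val) /= E; have := ltn_ord i; have := ltn_ord j;
    move: E; lia.
congr ideal_gen; apply/seteqP; split=> f.
  by move=> [s [t [st ->]]]; exists (pos s), (pos t); rewrite -pos_edge !posE.
move=> [v [w [vw ->]]]; have [s vs] := pos_surj v; have [t wt] := pos_surj w.
by exists s, t; rewrite pos_edge !posE -vs -wt.
Qed.

Lemma mpolyX_vertices (k : fieldType) (a : 'X_{1..11 + 19 + 29}) :
  'X_[a] = (\prod_(i < 11) x_ k i ^+ a (xv i)) *
    (\prod_(j < 19) y_ k j ^+ a (yv j)) * (\prod_(l < 29) z_ k l ^+ a (zv l)).
Proof. by rewrite mpolyXE_id !big_split_ord. Qed.

Lemma mpolyX_W1 (k : fieldType) : 'X_[W1] = \prod_(i < 11) x_ k i.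
Proof.
rewrite mpolyX_vertices [X in _ * X * _]big1 => [|j _]; last by rewrite W1E.
rewrite [X in _ * X]big1 => [|l _]; last by rewrite W1E.
by rewrite !mulr1; apply: eq_bigr => i _; rewrite W1E.
Qed.

Lemma mpolyX_W2 (k : fieldType) : 'X_[W2] = \prod_(j < 19) y_ k j.
Proof.
rewrite mpolyX_vertices big1 => [|i _]; last by rewrite W2E.
rewrite [X in _ * X]big1 => [|l _]; last by rewrite W2E.
by rewrite mul1r mulr1; apply: eq_bigr => j _; rewrite W2E.
Qed.

Lemma mpolyX_W3 (k : fieldType) : 'X_[W3] = \prod_(l < 29) z_ k l.
Proof.
rewrite mpolyX_vertices big1 => [|i _]; last by rewrite W3E.
rewrite [X in _ * X * _]big1 => [|j _]; last by rewrite W3E.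
by rewrite !mul1r; apply: eq_bigr => l _; rewrite W3E.
Qed.

Lemma lcm_seq_dvd s n : (forall d, d \in s -> d %| n)%N -> (lcm_seq s %| n)%N.
Proof.
move=> sn; rewrite /lcm_seq big_seq; elim/big_ind: _ => [|m p mn pn|d /sn //].
  exact: dvd1n.
by rewrite dvdn_lcm mn.
Qed.

Theorem mainTheorem3 (k : fieldType) :
  let R := {mpoly k[11 + 19 + 29]} in
  let I1 : set R := cycle_ideal (@x_ k) in
  let I2 : set R := cycle_ideal (@y_ k) in
  let I3 : set R := cycle_ideal (@z_ k) in
  let I : set R := ideal_add (ideal_add I1 I2) I3 in
  let w1 : R := \prod_(i < 11) x_ k i in
  let w2 : R := \prod_(j < 19) y_ k j in
  let w3 : R := \prod_(l < 29) z_ k l in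
  let degrees : seq nat := [:: 1; 6; 10; 15]%N in
  [/\ (I1 = edge_ideal (@cycle_graph 11) (@x_ k) /\
       I2 = edge_ideal (@cycle_graph 19) (@y_ k) /\
       I3 = edge_ideal (@cycle_graph 29) (@z_ k)) /\
      I = edge_ideal
            (disjoint_union
               (disjoint_union (@cycle_graph 11) (@cycle_graph 19))
               (@cycle_graph 29))
            (@xyz k),
      symbolic_Rees I =
        subalg_gen ([set a *: 'X | a in I] `|`
                    [set w1 *: 'X^6; w2 *: 'X^10; w3 *: 'X^15]),
      exists gens : seq (nat * R),
        Rees_generators I gens /\ [seq g.1 | g <- gens] =i degrees,
      svd I = Some 60%N /\ 60%N = (2 * lcm_seq degrees)%N &
      (lcm_seq degrees = 30%N /\ ext_ltn (lcm_seq degrees) (svd I)) /\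
      exists (n : nat) (J : set {mpoly k[n]}) (gens : seq (nat * {mpoly k[n]})),
        [/\ monomial_ideal J, Rees_generators J gens &
            ext_ltn (lcm_seq [seq g.1 | g <- gens]) (svd J)]].
Proof.
move=> R I1 I2 I3 I w1 w2 w3 degrees.
have IE : I = edge_ideal
    (disjoint_union
       (disjoint_union (@cycle_graph 11) (@cycle_graph 19)) (@cycle_graph 29))
    (@xyz k).
  by rewrite !edge_ideal_disjoint_union /I /I1 /I2 /I3 !cycle_idealE.
have IJ : I = edge_ideal three_cycles (fun v => 'X_v : R).
  by rewrite IE edge_ideal_xyz.
have svdI : svd I = Some 60%N by rewrite IJ svd_three_cycles.
have lcm30 : lcm_seq degrees = 30%N by rewrite /lcm_seq unlock.
split.
- by split=> //; rewrite /I1 /I2 /I3 !cycle_idealE.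
- by rewrite IJ symbolic_Rees_three_cycles mpolyX_W1 mpolyX_W2 mpolyX_W3.
- exists (Rees_gens k); split; last exact: Rees_gens_degrees.
  by rewrite IJ; apply: Rees_gens_generate.
- by rewrite svdI lcm30.
- split; first by rewrite svdI lcm30.
  exists (11 + 19 + 29)%N, I, (Rees_gens k); split.
  + by exists (edge_mnm three_cycles); rewrite IJ edge_ideal_mspan ideal_gen_mspan.
  + by rewrite IJ; apply: Rees_gens_generate.
  + rewrite svdI /=; apply: leq_ltn_trans (_ : 30 < 60)%N => //.
    (* The list of degrees has many repetitions of 1, so its lcm is bounded through divisibility of
       30 rather than computed. *)
    apply: dvdn_leq => //; apply: lcm_seq_dvd => d.
    by rewrite Rees_gens_degrees !inE => /or4P[] /eqP->.
Qed.
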